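(* Let $h>0$, let $B\subset\mathbb Z^8_h$ be bounded and let $f:\partial B\to\mathbb O$. Then: (1) there exists $u:\overline B\to\mathbb O$ with $D^hu(y)=0$ for every $y\in B$ and $u(y)=P^h_{\partial B}f(y)$ for every $y\in\partial B$; (2) there exists $v:\overline{\mathbb Z^8_h\setminus B}\to\mathbb O$ with $D^hv(y)=0$ for every $y\in\mathbb Z^8_h\setminus B$, $v(y)=Q^h_{\partial B}f(y)$ for every $y\in\partial B$, and $|v(y)|\to0$ as $|y|\to\infty$.
   Context: $\mathbb O$ is the real octonion algebra with basis $\mathbf e_0=1,\mathbf e_1,\dots,\mathbf e_7$, where $\mathbf e_i\mathbf e_j=-\delta_{ij}+\sum_k\varepsilon_{ijk}\mathbf e_k$ for $1\le i,j\le 7$, $\varepsilon_{ijk}$ totally antisymmetric with $\varepsilon_{ijk}=1$ for $ijk\in\{123,145,176,246,257,347,365\}$; $\overline{\mathbf e}_0=\mathbf e_0$, $\overline{\mathbf e}_l=-\mathbf e_l$ ($l\ge1$); $|\cdot|$ is the Euclidean norm. For $h>0$, $\mathbb Z^8_h=(h\mathbb Z)^8$, $e_0,\dots,e_7$ are the standard unit vectors of $\mathbb R^8$, $\chi_A$ is the indicator of $A$. $\partial_l^{+,h}f(x)=(f(x+he_l)-f(x))/h$, $\partial_l^{-,h}f(x)=(f(x)-f(x-he_l))/h$, $\partial_l^h=\frac12(\partial_l^{+,h}+\partial_l^{-,h})$, $D^hf=\sum_l\mathbf e_l\partial_l^hf$. $N(x)=\{x,x\pm he_0,\dots,x\pm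 he_7\}$; for $A\subset\mathbb Z^8_h$: $\partial A=\{x:\ N(x)\cap A\neq\emptyset,\ N(x)\cap(\mathbb Z^8_h\setminus A)\neq\emptyset\}$, $\overline A=A\cup\partial A$ (note $\partial(\mathbb Z^8_h\setminus B)=\partial B$). For $x\in\partial B$: $\Sigma(x)=\sum_l[(\partial_l^{+,h}\chi_B(x))^2+(\partial_l^{-,h}\chi_B(x))^2]$, $s(x)=\frac{h^8}{2}\sqrt{\Sigma(x)}$, $n_l^\pm(x)=-2\partial_l^{\pm,h}\chi_B(x)/\sqrt{\Sigma(x)}$, $\int_{\partial B}g\,dS=\sum_{x\in\partial B}g(x)s(x)$. Fundamental solution: $E^1(x)=\frac{1}{(2\pi)^8}\int_{[-\pi,\pi]^8}\frac{\sum_l\overline{\mathbf e}_l\sin u_l}{\sum_l\sin^2u_l}\sin(\sum_lu_lx_l)\,du$ ($x\in\mathbb Z^8$), $E^h(x)=h^{-7}E^1(x/h)$. Star product: $K^h(x,y)*g(x)=-\frac12\sum_{l=0}^7\big(E^h(he_l-x+y)n_l^-(x)+E^h(-he_l-x+y)n_l^+(x)\big)(\mathbf e_lg(x))$. For $g:\partial B\to\mathbb O$: $S^h_{\partial B}g(y)=2\int_{\partial B}K^h(x,y)*\big(g(x)-g(y)\big)dS(x)+g(y)$ ($y\in\partial B$), and the discrete Plemelj projections are $P^h_{\partial B}g=\frac12(g+S^h_{\partial B}g)$, $Q^h_{\partial B}g=\frac12(g-S^h_{\partial B}g)$. *)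

(* Defs.v *)
From HB Require Import structures.
From mathcomp Require Import all_boot all_order all_algebra.
From mathcomp Require Import all_classical all_reals all_analysis.
Set Implicit Arguments. Unset Strict Implicit. Unset Printing Implicit Defensive.
Import Order.TTheory GRing.Theory Num.Theory.
Import numFieldNormedType.Exports.
Local Open Scope classical_set_scope.
Local Open Scope ring_scope.

Definition oct (R : realType) := 'rV[R]_8.

Definition oct_triples : seq (nat * nat * nat) :=
  [:: (1,2,3); (1,4,5); (1,7,6); (2,4,6); (2,5,7); (3,4,7); (3,6,5)]%N.

Definition cyc_in (i j k : nat) : bool :=
  has (fun t => let: (a, b, c) := t in
        [|| (i, j, k) == (a, b, c), (i, j, k) == (b, c, a) | (i, j, k) == (c, a, b)])
      oct_triples.

Definition eps (i j k : nat) : int :=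
  if cyc_in i j k then 1 else if cyc_in j i k then -1 else 0.

Definition ebasis (R : realType) (l : 'I_8) : oct R := \row_m (m == l)%:R.

Definition emul (R : realType) (i j : 'I_8) : oct R :=
  if (i == 0 :> nat) then ebasis R j
  else if (j == 0 :> nat) then ebasis R i
  else \row_m (if (m == 0 :> nat) then - (i == j)%:R else (eps i j m)%:~R).

Definition omul (R : realType) (a b : oct R) : oct R :=
  \sum_(i < 8) \sum_(j < 8) (a 0 i * b 0 j) *: emul R i j.

Definition onorm (R : realType) (a : oct R) : R := Num.sqrt (\sum_(i < 8) a 0 i ^+ 2).

(** Lattice Z^8_h: the point h*k is represented by k : Z^8. *)
Definition Z8 := {ffun 'I_8 -> int}.

Definition shift (k : Z8) (l : 'I_8) (s : int) : Z8 :=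
  [ffun i => k i + (if i == l then s else 0)].

Definition latnorm (R : realType) (h : R) (k : Z8) : R :=
  Num.sqrt (\sum_(i < 8) (h * (k i)%:~R) ^+ 2).

Definition lat_bounded (B : set Z8) : Prop :=
  exists M : nat, forall k, B k -> forall i, (`|k i| <= M%:Z)%R.

Definition nbhd (x z : Z8) : Prop :=
  z = x \/ exists l, z = shift x l 1 \/ z = shift x l (-1).

Definition bd (A : set Z8) : set Z8 :=
  [set x | (exists z, nbhd x z /\ A z) /\ (exists z, nbhd x z /\ ~ A z)].

Definition clos (A : set Z8) : set Z8 := A `|` bd A.

Definition chi (R : realType) (B : set Z8) (k : Z8) : R := \1_B k.

Definition dplusR (R : realType) (h : R) (g : Z8 -> R) (l : 'I_8) (x : Z8) : R :=
  (g (shift x l 1) - g x) / h.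
Definition dminusR (R : realType) (h : R) (g : Z8 -> R) (l : 'I_8) (x : Z8) : R :=
  (g x - g (shift x l (-1))) / h.

Definition dplusO (R : realType) (h : R) (g : Z8 -> oct R) (l : 'I_8) (x : Z8) : oct R :=
  h^-1 *: (g (shift x l 1) - g x).
Definition dminusO (R : realType) (h : R) (g : Z8 -> oct R) (l : 'I_8) (x : Z8) : oct R :=
  h^-1 *: (g x - g (shift x l (-1))).
Definition dcentO (R : realType) (h : R) (g : Z8 -> oct R) (l : 'I_8) (x : Z8) : oct R :=
  2^-1 *: (dplusO h g l x + dminusO h g l x).

Definition Dh (R : realType) (h : R) (g : Z8 -> oct R) (x : Z8) : oct R :=
  \sum_(l < 8) omul (ebasis R l) (dcentO h g l x).

Definition Sig (R : realType) (h : R) (B : set Z8) (x : Z8) : R :=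
  \sum_(l < 8) (dplusR h (chi R B) l x ^+ 2 + dminusR h (chi R B) l x ^+ 2).

Definition sarea (R : realType) (h : R) (B : set Z8) (x : Z8) : R :=
  h ^+ 8 / 2 * Num.sqrt (Sig h B x).

Definition nplus (R : realType) (h : R) (B : set Z8) (l : 'I_8) (x : Z8) : R :=
  - 2 * dplusR h (chi R B) l x / Num.sqrt (Sig h B x).
Definition nminus (R : realType) (h : R) (B : set Z8) (l : 'I_8) (x : Z8) : R :=
  - 2 * dminusR h (chi R B) l x / Num.sqrt (Sig h B x).

(** Fundamental solution.  The integral over [-pi,pi]^8 is written as an
    iterated Lebesgue integral (the integrand is absolutely integrable). *)
Definition Ipi (R : realType) (F : R -> R) : R :=
  Rintegral (@lebesgue_measure R) `[(- pi)%R, pi] F.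

Definition tup8 (R : realType) (a0 a1 a2 a3 a4 a5 a6 a7 : R) : 'I_8 -> R :=
  fun i => nth 0 [:: a0; a1; a2; a3; a4; a5; a6; a7] i.

Definition int8 (R : realType) (F : ('I_8 -> R) -> R) : R :=
  Ipi (fun a0 => Ipi (fun a1 => Ipi (fun a2 => Ipi (fun a3 =>
  Ipi (fun a4 => Ipi (fun a5 => Ipi (fun a6 => Ipi (fun a7 =>
    F (tup8 a0 a1 a2 a3 a4 a5 a6 a7))))))))).

(* component m of  (sum_l conj(e_l) sin u_l) / (sum_l sin^2 u_l) * sin(sum_l u_l x_l) *)
Definition E1integrand (R : realType) (k : Z8) (m : 'I_8) (u : 'I_8 -> R) : R :=
  ((if m == 0 :> nat then 1 else -1) * sin (u m))
    / (\sum_(l < 8) sin (u l) ^+ 2)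
    * sin (\sum_(l < 8) u l * (k l)%:~R).

Definition E1 (R : realType) (k : Z8) : oct R :=
  \row_m ((2 * pi) ^- 8 * int8 (E1integrand k m)).

Definition Eh (R : realType) (h : R) (k : Z8) : oct R := h ^- 7 *: E1 R k.

Definition kidx (l : 'I_8) (s : int) (x y : Z8) : Z8 :=
  [ffun i => (if i == l then s else 0) - x i + y i].

Definition Kstar (R : realType) (h : R) (B : set Z8) (x y : Z8) (g : oct R) : oct R :=
  - (2^-1) *: \sum_(l < 8)
     omul (nminus h B l x *: Eh h (kidx l 1 x y) + nplus h B l x *: Eh h (kidx l (-1) x y))
          (omul (ebasis R l) g).

Definition Sh (R : realType) (h : R) (B : set Z8) (g : Z8 -> oct R) (y : Z8) : oct R :=
  2 *: (\sum_(x \in bd B) sarea h B x *: Kstar h B x y (g x - g y)) + g y.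

Definition Ph (R : realType) (h : R) (B : set Z8) (g : Z8 -> oct R) (y : Z8) : oct R :=
  2^-1 *: (g y + Sh h B g y).
Definition Qh (R : realType) (h : R) (B : set Z8) (g : Z8 -> oct R) (y : Z8) : oct R :=
  2^-1 *: (g y - Sh h B g y).

(* Main.v *)
Require Import Defs.
From HB Require Import structures.
From mathcomp Require Import all_boot all_order all_algebra.
From mathcomp Require Import all_classical all_reals all_analysis.
From mathcomp Require Import measurable_realfun.
From mathcomp Require Import ring lra zify.
Import Order.TTheory GRing.Theory Num.Theory.
Import numFieldNormedType.Exports.
Local Open Scope classical_set_scope.
Local Open Scope ring_scope.
Set Implicit Arguments.
Unset Strict Implicit.
Unset Printing Implicit Defensive.

(** Let [chi] be the indicator of [B] and
      [T f(y) = h^8 sum_(x in B) E^h(y - x) (D^h f(x))].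
    Summation by parts turns the boundary sum defining [S^h] into the discrete
    Borel-Pompeiu formula: the star product integral of [g] is [chi g - T g].
    Applied to [g = f - f(y)] it gives [S^h f = f - 2 T f], hence
    [P^h f = f - T f] and [Q^h f = T f].  As [D^h (T f) = chi D^h f], the
    functions [u = f - T f] and [v = T f] are as required.  Non-associativity is
    harmless, because [(l, m) |-> d_l E_m] is symmetric whereas the associator
    [[conj e_m, e_l, g]] is alternating.

    The integrand of [E^1] is bounded, since [|sin(u.x)| <= sum |x_l| |sin u_l|].
    With [S = sum sin^2 u_l], the integrals of [1 / (S + eps)] are bounded
    uniformly in [eps]: this removes the null set [S = 0] from the identity
    [sum_l d_l E_l = delta], and, through Bessel's inequality for
    [sin u_m / (S + eps)], it shows that [E^1] tends to 0 at infinity. *)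

(** * Integration of bounded measurable functions over [-pi, pi] *)

Section Ipi_theory.
Variable R : realType.
Notation mu := (@lebesgue_measure R).
Implicit Types (f g : R -> R) (M : R).

Lemma lebesgue_measure_pi : mu `[- pi, pi] = (2 * pi)%:E.
Proof.
by rewrite lebesgue_measure_itv /= lte_fin gtrN ?pi_gt0 // -EFinB; congr (_ %:E); ring.
Qed.

Lemma bounded_integrable_pi f M : measurable_fun setT f ->
  (forall t, `|f t| <= M) -> mu.-integrable `[- pi, pi] (EFin \o f).
Proof.
move=> mf fM; apply: measurable_bounded_integrable => //.
- by have := ltry (2 * pi : R); rewrite -lebesgue_measure_pi.
- exact: measurable_funS mf.
- by exists M; split => [|N MN t _]; [exact: num_real|exact: le_trans (fM t) (ltW MN)].
Qed.

Lemma IpiD f g M N : measurable_fun setT f -> measurable_fun setT g ->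
  (forall t, `|f t| <= M) -> (forall t, `|g t| <= N) ->
  Ipi (fun t => f t + g t) = Ipi f + Ipi g.
Proof.
by move=> mf mg fM gN; apply: RintegralD => //;
  [exact: bounded_integrable_pi fM|exact: bounded_integrable_pi gN].
Qed.

Lemma IpiZ f M a : measurable_fun setT f -> (forall t, `|f t| <= M) ->
  Ipi (fun t => a * f t) = a * Ipi f.
Proof. by move=> mf fM; apply: RintegralZl => //; exact: bounded_integrable_pi fM. Qed.

Lemma Ipi_cst (a : R) : Ipi (fun=> a) = 2 * pi * a.
Proof.
rewrite /Ipi (Rintegral_cst mu) // mulrC; congr (_ * a).
exact: (congr1 fine lebesgue_measure_pi).
Qed.

Lemma le_Ipi f g M N : measurable_fun setT f -> measurable_fun setT g ->
  (forall t, `|f t| <= M) -> (forall t, `|g t| <= N) ->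
  (forall t, f t <= g t) -> Ipi f <= Ipi g.
Proof.
by move=> mf mg fM gN fg; apply: le_Rintegral => //;
  [exact: bounded_integrable_pi fM|exact: bounded_integrable_pi gN].
Qed.

Lemma Ipi_bound f M : measurable_fun setT f -> (forall t, `|f t| <= M) ->
  `|Ipi f| <= 2 * pi * M.
Proof.
move=> mf fM; rewrite -Ipi_cst ler_norml; apply/andP; split.
  have -> : - Ipi (fun=> M) = Ipi (fun=> - M) by rewrite !Ipi_cst mulrN.
  apply: (@le_Ipi _ _ `|M| M) => // t; first by rewrite normrN.
  by have := fM t; rewrite ler_norml => /andP[].
by apply: (@le_Ipi _ _ M `|M|) => // t; exact: le_trans (ler_norm _) (fM t).
Qed.

(** Adding the constant [M] makes the integrand nonnegative, so that Tonelli's theorem gives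
    measurability in the parameter; the contribution 2 pi [M] is subtracted afterwards. *)
Lemma measurable_Ipi d (X : measurableType d) (F : X -> R -> R) M :
  measurable_fun setT (fun z : X * R => F z.1 z.2) ->
  (forall x t, `|F x t| <= M) ->
  measurable_fun setT (fun x => Ipi (F x)).
Proof.
move=> mF FM.
have mFx x : measurable_fun setT (F x).
  have -> : F x = (fun z : X * R => F z.1 z.2) \o (fun t => (x, t)) by [].
  by apply: measurableT_comp => //; exact: measurable_pair1.
have -> : (fun x => Ipi (F x)) = (fun x => Ipi (fun t => F x t + M) - 2 * pi * M).
  apply/funext => x; rewrite (@IpiD _ _ M `|M|) // Ipi_cst; ring.
apply: measurable_funB => //.
rewrite /Ipi /Rintegral.
apply: (measurableT_comp (@fine_measurable R setT measurableT)).
pose G (z : X * R) := (((F z.1 z.2 + M) * \1_(`[- pi, pi]) z.2)%:E)%E.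
have -> : (fun x => \int[mu]_(t in `[(- pi)%R, pi]) (F x t + M)%:E)%E =
          (fun x => \int[mu]_t G (x, t))%E.
  apply/funext => x; rewrite integral_mkcond; apply: eq_integral => t _.
  rewrite /G /= restrict_EFin /= /patch indicE.
  by case: ifP => _; rewrite ?mulr1 ?mulr0.
have := @measurable_fun_fubini_tonelli_F _ _ X _ R mu G; rewrite /fubini_F; apply.
- apply/measurable_EFinP/measurable_funM; first exact: measurable_funD.
  apply: (@measurableT_comp _ _ _ _ _ _ (\1_(`[- pi, pi]) : R -> R)) => //.
- move=> z; rewrite lee_fin mulr_ge0 ?indicE//.
  by have := FM z.1 z.2; rewrite ler_norml => /andP[+ _]; lra.
Qed.

End Ipi_theory.

(** * Iterated integrals in finitely many variables *)

Section iterated_integrals.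
Variables (R : realType) (I : eqType).
Implicit Types (F G : (I -> R) -> R) (c : I -> R) (s : seq I) (i : I).

(* Measurability of a function of several variables, tested along all
   measurable families of points rather than through a product sigma-algebra. *)
Definition mmeas F := forall d (X : measurableType d) (c : X -> I -> R),
  (forall i, measurable_fun setT (fun x => c x i)) ->
  measurable_fun setT (fun x => F (c x)).

(** Bounded measurable functions form an algebra stable under partial integration, so that every
    inner integral of an iterated integral is again integrable. *)
Definition bmeas F := mmeas F /\ exists M, forall c, `|F c| <= M.

Definition upd c i (t : R) : I -> R := fun j => if j == i then t else c j.

(** The result still takes a full point [c], whose entry at [i] is overwritten; partial integrals
    thus keep the type of the integrand and can be folded along a list, the head being the outermost
    variable. *)
Definition Jint i F : (I -> R) -> R := fun c => Ipi (fun t => F (upd c i t)).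

Definition Iint s F := foldr Jint F s.

Lemma mmeas_coord i : mmeas (fun c => c i).
Proof. by move=> d X c; exact. Qed.

Lemma mmeas_cst a : mmeas (fun=> a).
Proof. by move=> d X c mc; exact: measurable_cst. Qed.

Lemma mmeas_comp (f : R -> R) F : measurable_fun setT f -> mmeas F ->
  mmeas (fun c => f (F c)).
Proof.
by move=> mf mF d X c mc; apply: (measurableT_comp mf); exact: mF.
Qed.

Lemma mmeasD F G : mmeas F -> mmeas G -> mmeas (fun c => F c + G c).
Proof. by move=> mF mG d X c mc; apply: measurable_funD; [exact: mF|exact: mG]. Qed.

Lemma mmeasM F G : mmeas F -> mmeas G -> mmeas (fun c => F c * G c).
Proof. by move=> mF mG d X c mc; apply: measurable_funM; [exact: mF|exact: mG]. Qed.

Lemma mmeas_sum (J : Type) (r : seq J) (F : J -> (I -> R) -> R) :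
  (forall j, mmeas (F j)) -> mmeas (fun c => \sum_(j <- r) F j c).
Proof.
move=> mF; elim: r => [|j r IH].
  rewrite (_ : (fun c => _) = fun=> 0); first exact: mmeas_cst.
  by apply/funext => c; rewrite big_nil.
rewrite (_ : (fun c => _) = fun c => F j c + \sum_(j <- r) F j c); first exact: mmeasD.
by apply/funext => c; rewrite big_cons.
Qed.

(** The test family is parametrised by the product of [X] and [R]. This joint measurability is what
    [measurable_Ipi] asks for, and it is the reason why [mmeas] quantifies over all measurable
    spaces. *)
Lemma mmeas_upd F i d (X : measurableType d) (c : X -> I -> R) : mmeas F ->
  (forall i, measurable_fun setT (fun x => c x i)) ->
  measurable_fun setT (fun z : X * R => F (upd (c z.1) i z.2)).
Proof.
move=> mF mc; apply: (mF _ _ (fun z : X * R => upd (c z.1) i z.2)) => j.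
rewrite /upd; case: (j == i); first exact: measurable_snd.
by apply: (measurableT_comp (mc j)); exact: measurable_fst.
Qed.

Lemma mmeas_upd1 F i c : mmeas F -> measurable_fun setT (fun t => F (upd c i t)).
Proof.
move=> mF; apply: (mF _ _ (fun t => upd c i t)) => j.
by rewrite /upd; case: (j == i); [exact: measurable_id|exact: measurable_cst].
Qed.

Lemma bmeas_cst a : bmeas (fun=> a).
Proof. by split; [exact: mmeas_cst|exists `|a|]. Qed.

Lemma bmeasD F G : bmeas F -> bmeas G -> bmeas (fun c => F c + G c).
Proof.
move=> [mF [M FM]] [mG [N GN]]; split; first exact: mmeasD.
by exists (M + N) => c; rewrite (le_trans (ler_normD _ _)) ?lerD.
Qed.

Lemma bmeasM F G : bmeas F -> bmeas G -> bmeas (fun c => F c * G c).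
Proof.
move=> [mF [M FM]] [mG [N GN]]; split; first exact: mmeasM.
by exists (M * N) => c; rewrite normrM ler_pM.
Qed.

Lemma bmeasZ F a : bmeas F -> bmeas (fun c => a * F c).
Proof. exact/bmeasM/bmeas_cst. Qed.

Lemma bmeasB F G : bmeas F -> bmeas G -> bmeas (fun c => F c - G c).
Proof.
move=> bF bG; rewrite (_ : (fun c => _) = fun c => F c + (-1) * G c).
  exact/bmeasD/bmeasZ.
by apply/funext => c; rewrite mulN1r.
Qed.

Lemma bmeas_sum (J : Type) (r : seq J) (F : J -> (I -> R) -> R) :
  (forall j, bmeas (F j)) -> bmeas (fun c => \sum_(j <- r) F j c).
Proof.
move=> mF; elim: r => [|j r IH].
  rewrite (_ : (fun c => _) = fun=> 0); first exact: bmeas_cst.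
  by apply/funext => c; rewrite big_nil.
rewrite (_ : (fun c => _) = fun c => F j c + \sum_(j <- r) F j c); first exact: bmeasD.
by apply/funext => c; rewrite big_cons.
Qed.

Lemma bmeas_Jint i F : bmeas F -> bmeas (Jint i F).
Proof.
move=> [mF [M FM]]; split => [d X c mc|].
  apply: (@measurable_Ipi _ _ _ (fun x t => F (upd (c x) i t)) M) => //.
  exact: (mmeas_upd i mF mc).
by exists (2 * pi * M) => c; apply: Ipi_bound => //; exact: mmeas_upd1.
Qed.

Lemma bmeas_Iint s F : bmeas F -> bmeas (Iint s F).
Proof. by move=> bF; elim: s => //= i s; exact: bmeas_Jint. Qed.

Lemma IintD s F G : bmeas F -> bmeas G ->
  Iint s (fun c => F c + G c) = (fun c => Iint s F c + Iint s G c).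
Proof.
move=> bF bG; elim: s => //= i s ->; apply/funext => c.
have [mF [M FM]] := bmeas_Iint s bF; have [mG [N GN]] := bmeas_Iint s bG.
by apply: (@IpiD _ _ _ M N) => //; exact: mmeas_upd1.
Qed.

Lemma IintZ s F a : bmeas F ->
  Iint s (fun c => a * F c) = (fun c => a * Iint s F c).
Proof.
move=> bF; elim: s => //= i s ->; apply/funext => c.
have [mF [M FM]] := bmeas_Iint s bF.
by apply: (@IpiZ _ _ M) => //; exact: mmeas_upd1.
Qed.

Lemma IintB s F G : bmeas F -> bmeas G ->
  Iint s (fun c => F c - G c) = (fun c => Iint s F c - Iint s G c).
Proof.
move=> bF bG; rewrite (_ : (fun c => F c - G c) = fun c => F c + (-1) * G c).
  rewrite IintD ?IintZ//; first by apply/funext => c; rewrite mulN1r.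
  exact: bmeasZ.
by apply/funext => c; rewrite mulN1r.
Qed.

Lemma Iint_cst s a : Iint s (fun=> a) = fun=> (2 * pi) ^+ size s * a.
Proof.
elim: s => [|i s /= ->]; first by apply/funext => c; rewrite expr0 mul1r.
by apply/funext => c; rewrite /Jint Ipi_cst exprS mulrA.
Qed.

Lemma Iint_sum s (J : Type) (r : seq J) (F : J -> (I -> R) -> R) :
  (forall j, bmeas (F j)) ->
  Iint s (fun c => \sum_(j <- r) F j c) = fun c => \sum_(j <- r) Iint s (F j) c.
Proof.
move=> bF; elim: r => [|j r IH].
  rewrite (_ : (fun c => _) = fun=> 0); last by apply/funext => c; rewrite big_nil.
  by rewrite Iint_cst mulr0; apply/funext => c; rewrite big_nil.
rewrite (_ : (fun c => _) = fun c => F j c + \sum_(j <- r) F j c); last first.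
  by apply/funext => c; rewrite big_cons.
by rewrite IintD ?IH//; [apply/funext => c; rewrite big_cons|exact: bmeas_sum].
Qed.

Lemma le_Iint s F G : bmeas F -> bmeas G -> (forall c, F c <= G c) ->
  forall c, Iint s F c <= Iint s G c.
Proof.
move=> bF bG FG; elim: s => //= i s IH c.
have [mF [M FM]] := bmeas_Iint s bF; have [mG [N GN]] := bmeas_Iint s bG.
by apply: (@le_Ipi _ _ _ M N) => //; exact: mmeas_upd1.
Qed.

Lemma Iint_ge0 s F : bmeas F -> (forall c, 0 <= F c) -> forall c, 0 <= Iint s F c.
Proof.
move=> bF F0 c; have := le_Iint s (bmeas_cst 0) bF F0 c.
by rewrite Iint_cst mulr0.
Qed.

Lemma Iint_norm s F G : bmeas F -> bmeas G -> (forall c, `|F c| <= G c) ->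
  forall c, `|Iint s F c| <= Iint s G c.
Proof.
move=> bF bG FG c; rewrite ler_norml.
have -> : - Iint s G c = Iint s (fun c => -1 * G c) c by rewrite IintZ // mulN1r.
have bG' : bmeas (fun c => -1 * G c) by exact: bmeasZ.
apply/andP; split; apply: le_Iint => // {}c; have := FG c; rewrite ler_norml.
  by rewrite mulN1r => /andP[].
by move=> /andP[].
Qed.

(** The list [r] of factors is kept apart from the list [s] of integrated variables to make the
    induction on [s] possible: each step turns one more factor into its integral. *)
Lemma Iint_prod s (g : I -> R -> R) : uniq s ->
  (forall i, measurable_fun setT (g i)) -> (forall i, exists M, forall t, `|g i t| <= M) ->
  forall r, {subset s <= r} -> uniq r ->
  Iint s (fun c => \prod_(i <- r) g i (c i)) =
  fun c => (\prod_(i <- s) Ipi (g i)) * \prod_(i <- r | i \notin s) g i (c i).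
Proof.
move=> us mg bg r sr ur; elim: s us sr => [|i s IH] /=.
  by move=> _ _; apply/funext => c; rewrite big_nil mul1r.
move=> /andP[nis us] sr; rewrite IH //; last first.
  by move=> j js; apply: sr; rewrite inE js orbT.
have ir : i \in r by apply: sr; rewrite inE eqxx.
apply/funext => c; rewrite /Jint big_cons.
have [M gM] := bg i.
transitivity (Ipi (fun t => ((\prod_(j <- s) Ipi (g j)) *
   \prod_(j <- r | j \notin i :: s) g j (c j)) * g i t)); last first.
  by rewrite (IpiZ _ (mg i) gM); ring.
congr Ipi; apply/funext => t; rewrite -mulrA; congr (_ * _).
rewrite -[LHS]big_filter (bigD1_seq i) ?mem_filter ?nis ?filter_uniq //=.
rewrite big_filter_cond /upd eqxx mulrC; congr (_ * _).
apply: eq_big => [j|j /andP[_ /negPf ->]//].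
by rewrite inE negb_or andbC.
Qed.

End iterated_integrals.

(** * One-variable integrals: orthogonality of cosines and the singularity |sin|^(-1/2) *)

Section one_variable.
Variable R : realType.
Implicit Types (f F : R -> R) (t eta : R).

Lemma derivable_continuous f : (forall t, derivable f t 1) -> continuous f.
Proof.
by move=> df t; apply: differentiable_continuous; rewrite -derivable1_diffP.
Qed.

Lemma Ipi_derive F f : (forall t, is_derive t 1 F (f t)) -> continuous f ->
  Ipi f = F pi - F (- pi).
Proof.
move=> dF cf; have cF : continuous F.
  by apply: derivable_continuous => t; have [] := dF t.
rewrite /Ipi /Rintegral (@continuous_FTC2 _ f F) //.
- by rewrite gtrN ?pi_gt0.
- exact: continuous_subspaceT.
- split => [t _||]; first by have [] := dF t.
  + exact/cvg_at_right_filter/cF.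
  + exact/cvg_at_left_filter/cF.
- by move=> t _; rewrite derive1E; have [_ ->] := dF t.
Qed.

Lemma sin_intpi (n : int) : sin (pi * n%:~R) = 0 :> R.
Proof.
have H (k : nat) : sin (pi * k%:R) = 0 :> R.
  elim: k => [|k IH]; first by rewrite mulr0 sin0.
  by rewrite -natr1 mulrDr mulr1 sinDpi IH oppr0.
case: n => k; first exact: H.
by rewrite NegzE mulrNz mulrN sinN H oppr0.
Qed.

(** For nonzero [n] the primitive sin(th + n t) / n takes the same value at -pi and pi. All
    orthogonality relations below come from here. *)
Lemma Ipi_cosD th (n : int) :
  Ipi (fun t => cos (th + t * n%:~R)) = (if n == 0 then 2 * pi * cos th else 0) :> R.
Proof.
case: eqVneq => [->|n0].
  by rewrite (_ : (fun t => _) = fun=> cos th) ?Ipi_cst//; apply/funext => t; rewrite mulr0 addr0.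
have n0' : n%:~R != 0 :> R by rewrite intr_eq0.
have dF t : is_derive t 1 (fun t => n%:~R^-1 * sin (th + t * n%:~R)) (cos (th + t * n%:~R)).
  by apply: is_derive_eq; rewrite /GRing.scale /=; field.
rewrite (Ipi_derive dF); first by rewrite mulNr sinB sinD !sin_intpi; ring.
apply: derivable_continuous => t; apply: ex_derive.
Qed.

(** This is (sin^2 t + eta)^(-1/4), written with exponential and logarithm to be differentiated; it
    is smooth for positive [eta]. *)
Definition root4V eta t : R := expR (- (4^-1 * ln (sin t ^+ 2 + eta))).

Lemma root4V_gt0 eta t : 0 < root4V eta t.
Proof. exact: expR_gt0. Qed.

Lemma root4VE eta t : 0 < eta -> root4V eta t ^+ 4 * (sin t ^+ 2 + eta) = 1.
Proof.
move=> e0; have p0 : 0 < sin t ^+ 2 + eta by rewrite ltr_wpDl ?sqr_ge0.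
rewrite -[X in _ * X](@lnK _ (sin t ^+ 2 + eta)) ?posrE //.
rewrite /root4V -expRM_natl -expRD -[RHS]expR0; congr expR; lra.
Qed.

Lemma is_derive_root4V eta t : 0 < eta -> is_derive t 1 (root4V eta)
  (- (root4V eta t * (sin t * cos t) / (2 * (sin t ^+ 2 + eta)))).
Proof.
move=> e0; have p0 : 0 < sin t ^+ 2 + eta by rewrite ltr_wpDl ?sqr_ge0.
have d1 : is_derive (sin t ^+ 2 + eta) 1 (@ln R) (sin t ^+ 2 + eta)^-1.
  exact: is_derive1_ln.
rewrite /root4V; apply: is_derive_eq; rewrite /GRing.scale /=.
by field; rewrite gt_eqF.
Qed.

Lemma root4V_continuous eta : 0 < eta -> continuous (root4V eta).
Proof.
by move=> e0; apply: derivable_continuous => t; have [] := is_derive_root4V t e0.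
Qed.

(** With r the fourth root: if r <= 1 use sin^2 <= 1; if r > 1 then sin^2 r <= sin^2 r^4 <= (sin^2 +
    eta) r^4 = 1. *)
Lemma sin2root4V_le1 eta t : 0 < eta -> sin t ^+ 2 * root4V eta t <= 1.
Proof.
move=> e0; have := root4VE t e0; have := root4V_gt0 eta t; set r := root4V eta t => r0 rE.
have s1 : sin t ^+ 2 <= 1 by have := cos2Dsin2 t; have := sqr_ge0 (cos t); lra.
have s0 := sqr_ge0 (sin t).
have [r1|r1] := leP r 1; first by nra.
have : sin t ^+ 2 * r ^+ 4 <= 1.
  by rewrite -rE mulrC ler_pM2l ?exprn_gt0// lerDl ltW.
apply: le_trans; rewrite ler_wpM2l // -[X in X <= _]expr1.
by apply: ler_weXn2l => //; exact: ltW.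
Qed.

(** This bound blows up as [eta] tends to 0; it only certifies integrability, whereas the bound on
    the integral in [Ipi_root4V] is uniform. *)
Lemma root4V_bound eta t : 0 < eta -> `|root4V eta t| <= eta^-1 + 1.
Proof.
move=> e0; rewrite gtr0_norm ?root4V_gt0//.
have := root4VE t e0; have := root4V_gt0 eta t; set r := root4V eta t => r0 rE.
have ei : 0 < eta^-1 by rewrite invr_gt0.
have [r1|r1] := leP r 1; first by lra.
suff : r <= eta^-1 by lra.
rewrite -[leRHS]mul1r -rE ler_pdivlMr //.
apply: ler_pM; [exact: ltW|exact: ltW| |].
  by rewrite -[X in X <= _]expr1; apply: ler_weXn2l => //; exact: ltW.
by rewrite lerDr sqr_ge0.
Qed.

(* With [r = (sin^2 + eta)^(-1/4)] and [G = sin cos r] one has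
   [r <= 2 G' + 3 sin^2 r], and [G'] integrates to 0 over a period. *)
Lemma Ipi_root4V eta : 0 < eta -> Ipi (root4V eta) <= 6 * pi.
Proof.
move=> e0.
pose G t := sin t * cos t * root4V eta t.
pose g t := cos t ^+ 2 * root4V eta t - sin t ^+ 2 * root4V eta t
  - (sin t * cos t) ^+ 2 * root4V eta t / (2 * (sin t ^+ 2 + eta)).
have p0 t : 0 < sin t ^+ 2 + eta by rewrite ltr_wpDl ?sqr_ge0.
have dG t : is_derive t 1 G (g t).
  have d1 := is_derive_root4V t e0.
  rewrite /G; apply: is_derive_eq; rewrite /GRing.scale /= /g.
  by field; rewrite gt_eqF.
have cg : continuous g.
  apply: derivable_continuous => t; have d1 := is_derive_root4V t e0.
  have n0 : 2 * (sin t ^+ 2 + eta) != 0 by rewrite mulf_neq0 ?gt_eqF.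
  rewrite /g; apply: ex_derive.
have I0 : Ipi g = 0.
  by rewrite (Ipi_derive dG cg) /G sinN sinpi; ring.
have gE t : `|g t| <= 3 * (eta^-1 + 1) /\ root4V eta t <= 2 * g t + 3.
  have := root4V_bound t e0; have := root4V_gt0 eta t; have := sin2root4V_le1 t e0.
  rewrite /g; set r := root4V eta t => sr1 r0; rewrite gtr0_norm// => rM.
  have cs := cos2Dsin2 t; have s0 := sqr_ge0 (sin t); have c0 := sqr_ge0 (cos t).
  (* Since sin^2 <= sin^2 + eta, one has 2 A <= cos^2 r. Hence 2 g >= cos^2 r - 2 sin^2 r, and
     adding 3 sin^2 r <= 3 gives r <= 2 g + 3. *)
  set A := (sin t * cos t) ^+ 2 * r / (2 * (sin t ^+ 2 + eta)).
  have A0 : 0 <= A.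
    apply: divr_ge0; apply: mulr_ge0 => //; try exact: ltW; exact: sqr_ge0.
  have A1 : 2 * A <= cos t ^+ 2 * r.
    rewrite /A mulrA ler_pdivrMr ?mulr_gt0// exprMn.
    have : 0 <= cos t ^+ 2 * r * eta by apply: mulr_ge0; [apply: mulr_ge0|]=> //; exact: ltW.
    by nra.
  have B0 : 0 <= cos t ^+ 2 * r by apply: mulr_ge0 => //; exact: ltW.
  have B1 : 0 <= sin t ^+ 2 * r by apply: mulr_ge0 => //; exact: ltW.
  have B2 : cos t ^+ 2 * r + sin t ^+ 2 * r = r by rewrite -mulrDl cs mul1r.
  split; last by lra.
  by rewrite ler_norml; apply/andP; split; lra.
have mg : measurable_fun setT g by exact: continuous_measurable_fun.
have mr : measurable_fun setT (root4V eta).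
  by apply: continuous_measurable_fun; exact: root4V_continuous.
have gM t := (gE t).1.
have m2g : measurable_fun setT (fun t => 2 * g t) by exact: measurable_funM.
have g2M t : `|2 * g t| <= 2 * (3 * (eta^-1 + 1)).
  by rewrite normrM ger0_norm// ler_pM2l.
have -> : 6 * pi = Ipi (fun t => 2 * g t + 3).
  rewrite (@IpiD _ _ (fun=> 3) (2 * (3 * (eta^-1 + 1))) 3) ?ger0_norm//.
  by rewrite (IpiZ _ mg gM) I0 Ipi_cst; ring.
apply: (@le_Ipi _ _ _ (eta^-1 + 1) (2 * (3 * (eta^-1 + 1)) + 3)) => //.
- exact: measurable_funD.
- by move=> t; exact: root4V_bound.
- by move=> t; rewrite (le_trans (ler_normD _ _))// lerD// ger0_norm.
- by move=> t; exact: (gE t).2.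
Qed.

End one_variable.

(** * Integrals over the cube [-pi, pi]^8 *)

Section lattice_integrals.
Variable R : realType.
Implicit Types (c : 'I_8 -> R) (k : Z8) (m l : 'I_8).

(** The list is explicit so that [Iint] along it unfolds to the eight nested integrals of [int8]. *)
Definition ords8 : seq 'I_8 := [:: @Ordinal 8 0 isT; @Ordinal 8 1 isT;
  @Ordinal 8 2 isT; @Ordinal 8 3 isT; @Ordinal 8 4 isT; @Ordinal 8 5 isT;
  @Ordinal 8 6 isT; @Ordinal 8 7 isT].

Lemma mem_ords8 m : m \in ords8.
Proof. by case: m => -[|[|[|[|[|[|[|[|//]]]]]]]] ?; rewrite !inE. Qed.

Lemma sum_ords8 (A : zmodType) (F : 'I_8 -> A) : \sum_(l <- ords8) F l = \sum_l F l.
Proof.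
rewrite !big_ord_recl big_ord0 !big_cons big_nil.
by do 8!(congr (_ + _); first by congr F; apply: val_inj).
Qed.

Lemma int8E (F : ('I_8 -> R) -> R) : int8 F = Iint ords8 F (fun=> 0).
Proof.
rewrite /int8 /Iint /ords8 [foldr _ _ _]/= /Jint.
do 8!(apply: (congr1 (@Ipi R)); apply/funext => ?).
apply: (congr1 F); apply/funext => -[i hi].
by do 8!(case: i hi => [|i] hi //).
Qed.

Definition ip k c : R := \sum_l c l * (k l)%:~R.

Definition S2 c : R := \sum_l sin (c l) ^+ 2.

Lemma S2_ge0 c : 0 <= S2 c.
Proof. by apply: sumr_ge0 => l _; exact: sqr_ge0. Qed.

Lemma sin2_le_S2 c l : sin (c l) ^+ 2 <= S2 c.
Proof.
rewrite /S2 (bigD1 l) //= lerDl; apply: sumr_ge0 => j _; exact: sqr_ge0.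
Qed.

Lemma mmeas_sin m : mmeas (fun c => sin (c m)).
Proof.
apply: (mmeas_comp (continuous_measurable_fun (@continuous_sin R))).
exact: mmeas_coord.
Qed.

Lemma mmeas_ip k : mmeas (ip k).
Proof.
apply: mmeas_sum => l; apply: mmeasM; [exact: mmeas_coord|exact: mmeas_cst].
Qed.

Lemma mmeas_S2 : mmeas S2.
Proof. by apply: mmeas_sum => l; apply: mmeasM; exact: mmeas_sin. Qed.

Lemma mmeasV (F : ('I_8 -> R) -> R) : mmeas F -> (forall c, 0 <= F c) ->
  mmeas (fun c => (F c)^-1).
Proof.
(* On nonnegative reals, 0 included by the convention 0^-1 = 0, the inverse is the power -1, a
   measurable function. *)
move=> mF F0; rewrite (_ : (fun c => _) = fun c => F c `^ (-1)).
  by apply: (@mmeas_comp _ _ (fun x => x `^ (-1))) => //; exact: measurable_powR.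
by apply/funext => c; rewrite powR_inv1.
Qed.

Lemma bmeas_sin m : bmeas (fun c => sin (c m)).
Proof. by split; [exact: mmeas_sin|exists 1 => c; exact: sin_max]. Qed.

Lemma bmeas_sin_ip k : bmeas (fun c => sin (ip k c)).
Proof.
split; last by exists 1 => c; exact: sin_max.
apply: (mmeas_comp (continuous_measurable_fun (@continuous_sin R))).
exact: mmeas_ip.
Qed.

Lemma bmeas_cos_ip k : bmeas (fun c => cos (ip k c)).
Proof.
split; last by exists 1 => c; exact: cos_max.
apply: (mmeas_comp (continuous_measurable_fun (@continuous_cos R))).
exact: mmeas_ip.
Qed.

Lemma bmeas_S2V e : 0 < e -> bmeas (fun c => (S2 c + e)^-1).
Proof.
move=> e0; have p0 c : 0 < S2 c + e by rewrite ltr_wpDl ?S2_ge0.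
split.
  apply: mmeasV => [|c]; last exact: ltW.
  by apply: mmeasD; [exact: mmeas_S2|exact: mmeas_cst].
exists e^-1 => c; rewrite gtr0_norm ?invr_gt0// lef_pV2 ?posrE//.
by rewrite lerDr S2_ge0.
Qed.

Lemma Iint_cos_ip k s : Iint s (fun c => cos (ip k c)) =
  fun c => (if all (fun i => k i == 0) s then (2 * pi) ^+ size s else 0) * cos (ip k c).
Proof.
elim: s => [|i s /= ->]; first by apply/funext => c; rewrite /= expr0 mul1r.
apply/funext => c; rewrite /Jint.
set a := if all _ _ then _ else _.
(* The phase splits into a part independent of coordinate [i] and the term t k_i, which reduces the
   step to [Ipi_cosD]. *)
pose th := \sum_(l | l != i) c l * (k l)%:~R.
have ipE t : ip k (upd c i t) = th + t * (k i)%:~R.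
  rewrite /ip (bigD1 i)//= addrC /upd eqxx; congr (_ + _).
  by apply: eq_bigr => l /negPf ->.
have -> : (fun t => a * cos (ip k (upd c i t))) = fun t => a * cos (th + t * (k i)%:~R).
  by apply/funext => t; rewrite ipE.
rewrite (@IpiZ _ _ 1); last 2 first.
- apply: continuous_measurable_fun; apply: derivable_continuous => t.
  apply: ex_derive.
- by move=> t; exact: cos_max.
rewrite Ipi_cosD; case: eqVneq => [ki0|] /=; last by rewrite mulr0 mul0r.
have -> : ip k c = th by rewrite /ip (bigD1 i)//= ki0 mulr0 add0r.
by rewrite /a; case: ifP => _; rewrite ?mul0r// exprS; ring.
Qed.

Lemma Iint_cos k : Iint ords8 (fun c => cos (ip k c)) (fun=> 0) =
  if k == 0 then (2 * pi) ^+ 8 else 0.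
Proof.
rewrite Iint_cos_ip /ip big1 ?cos0 ?mulr1 => [|l _]; last by rewrite mul0r.
have -> : all (fun i => k i == 0) ords8 = (k == 0) => //.
apply/allP/eqP => [H|-> i _]; last by rewrite ffunE.
by apply/ffunP => i; rewrite ffunE; apply/eqP/H/mem_ords8.
Qed.

(** AM-GM for the fourth roots x_j = 1 / r_j of p_j: the product of four of them is at most a
    quarter of the sum of their fourth powers, hence at most [T]. *)
Lemma inv_le_prod4 (J : Type) (p r : J -> R) T (j0 j1 j2 j3 : J) :
  (forall j, 0 < r j) -> (forall j, r j ^+ 4 * p j = 1) ->
  p j0 + p j1 + p j2 + p j3 <= T -> T^-1 <= r j0 * (r j1 * (r j2 * r j3)).
Proof.
move=> r0 rp pT.
pose x j := (r j)^-1.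
have x0 j : 0 < x j by rewrite invr_gt0.
have pE j : p j = x j ^+ 4.
  apply: (@mulfI _ (r j ^+ 4)); first by rewrite expf_neq0 ?gt_eqF.
  by rewrite rp /x exprVn divff// expf_neq0 ?gt_eqF.
have -> : r j0 * (r j1 * (r j2 * r j3)) = (x j0 * (x j1 * (x j2 * x j3)))^-1.
  by rewrite /x !invfM !invrK.
have X0 : 0 < x j0 * (x j1 * (x j2 * x j3)) by rewrite !mulr_gt0.
suff XT : x j0 * (x j1 * (x j2 * x j3)) <= T.
  by rewrite lef_pV2 ?posrE// (lt_le_trans X0).
apply: le_trans pT; rewrite !pE.
set a := x _; set b := x _; set d := x _; set e := x _.
have H1 (u v : R) : 2 * (u * v) <= u ^+ 2 + v ^+ 2.
  by have := sqr_ge0 (u - v); nra.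
have ab := H1 (a ^+ 2) (b ^+ 2); have de := H1 (d ^+ 2) (e ^+ 2).
have abde := H1 (a * b) (d * e).
have a4 := sqr_ge0 (a ^+ 2); have b4 := sqr_ge0 (b ^+ 2).
have d4 := sqr_ge0 (d ^+ 2); have e4 := sqr_ge0 (e ^+ 2).
by lra.
Qed.

(** Four coordinates contribute the bound 6 pi of [Ipi_root4V], the other four the length 2 pi of
    the interval. *)
Definition Cgreen : R := (6 * pi) ^+ 4 * (2 * pi) ^+ 4.

Lemma Cgreen_ge0 : 0 <= Cgreen.
Proof. by rewrite mulr_ge0// exprn_ge0// mulr_ge0// pi_ge0. Qed.

(* By AM-GM the integrand is at most a product of four functions of one
   variable, each with an integrable singularity [|sin|^(-1/2)]. *)
Lemma Iint_S2V e : 0 < e ->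
  Iint ords8 (fun c => (S2 c + e)^-1) (fun=> 0) <= Cgreen.
Proof.
move=> e0; have e4 : 0 < e / 4 by rewrite divr_gt0.
(* Four factors of exponent -1/4 make up the exponent -1. Each of the first four coordinates
   receives a quarter of [e]; the sines of the other four are discarded from [S2]. *)
pose g (i : 'I_8) t := if (i < 4)%N then root4V (e / 4) t else 1.
have mg i : measurable_fun setT (g i).
  rewrite /g; case: (i < 4)%N; last exact: measurable_cst.
  by apply: continuous_measurable_fun; exact: root4V_continuous.
have bg i : exists M, forall t, `|g i t| <= M.
  rewrite /g; case: (i < 4)%N; last by exists `|1|.
  by exists ((e / 4)^-1 + 1) => t; exact: root4V_bound.
have bG : bmeas (fun c => \prod_(i <- ords8) g i (c i)).
  elim: ords8 => [|i s IH].
    rewrite (_ : (fun c => _) = fun=> 1); first exact: bmeas_cst.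
    by apply/funext => c; rewrite big_nil.
  rewrite (_ : (fun c => _) = fun c => g i (c i) * \prod_(j <- s) g j (c j)).
    apply: bmeasM => //; split; first by apply: mmeas_comp => //; exact: mmeas_coord.
    by have [M gM] := bg i; exists M.
  by apply/funext => c; rewrite big_cons.
apply: (@le_trans _ _ (Iint ords8 (fun c => \prod_(i <- ords8) g i (c i)) (fun=> 0))).
  apply: le_Iint => //; first exact: bmeas_S2V.
  move=> c; rewrite !big_cons big_nil /g /= !mulr1.
  apply: (@inv_le_prod4 _ (fun i => sin (c i) ^+ 2 + e / 4) (fun i => root4V (e / 4) (c i))).
  - by move=> i; exact: root4V_gt0.
  - by move=> i; exact: root4VE.
  - rewrite /S2 -sum_ords8 !big_cons big_nil.
    have s0 i : 0 <= sin (c i) ^+ 2 by exact: sqr_ge0.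
    have := s0 (@Ordinal 8 4 isT); have := s0 (@Ordinal 8 5 isT).
    have := s0 (@Ordinal 8 6 isT); have := s0 (@Ordinal 8 7 isT).
    by lra.
rewrite Iint_prod // [X in _ * X]big1_seq; last by move=> i; rewrite mem_ords8.
have I1 : Ipi (fun=> 1) = 2 * pi :> R by rewrite Ipi_cst mulr1.
have g6 := Ipi_root4V e4.
have g0 : 0 <= Ipi (root4V (e / 4)).
  by apply: Rintegral_ge0 => t _; exact: ltW (root4V_gt0 _ _).
rewrite mulr1 !big_cons big_nil /g /= !I1 mulr1 /Cgreen.
set q := Ipi _ in g6 g0 *.
have p0 : 0 <= 2 * pi :> R by rewrite mulr_ge0 ?pi_ge0.
have -> : q * (q * (q * (q * (2 * pi * (2 * pi * (2 * pi * (2 * pi))))))) =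
  q ^+ 4 * (2 * pi) ^+ 4 by ring.
by rewrite ler_wpM2r ?exprn_ge0// lerXn2r ?nnegrE// (le_trans g0).
Qed.

End lattice_integrals.

Lemma sum_delta (A : zmodType) (J : eqType) (s : seq J) (i : J) (F : J -> A) : uniq s ->
  \sum_(j <- s) (if j == i then F j else 0) = if i \in s then F i else 0.
Proof.
move=> us; rewrite -big_mkcond /=; case: ifPn => [is_|is_].
  by rewrite -big_filter filter_pred1_uniq// big_seq1.
rewrite big_seq_cond big1// => j /andP[js /eqP ji].
by move: is_; rewrite -ji js.
Qed.

(** * Components of the fundamental solution and their decay *)

Section fundamental_solution.
Variable R : realType.
Implicit Types (c : 'I_8 -> R) (k : Z8) (m l : 'I_8).
Notation I8 F := (Iint ords8 F (fun=> (0 : R))).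
Notation V := ((2 * pi : R) ^+ 8).

Definition basisZ8 l : Z8 := [ffun i => if i == l then 1 else 0].

Lemma ipD k k' c : ip (k + k') c = ip k c + ip k' c :> R.
Proof.
by rewrite /ip -big_split; apply: eq_bigr => l _ /=; rewrite ffunE intrD mulrDr.
Qed.

Lemma ipN k c : ip (- k) c = - ip k c :> R.
Proof.
by rewrite /ip -sumrN; apply: eq_bigr => l _ /=; rewrite ffunE intrN mulrN.
Qed.

Lemma ip_basisZ8 l c : ip (basisZ8 l) c = c l :> R.
Proof.
rewrite /ip (bigD1 l)//= ffunE eqxx mulr1 big1 ?addr0// => i /negPf il.
by rewrite ffunE il mulr0.
Qed.

(** Up to the conjugation sign, the integrand of component [m] of E^1. Where [S2] vanishes, division
    by zero gives the value 0. *)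
Definition eint m k c : R := sin (c m) / S2 c * sin (ip k c).

Definition nrm1 k : R := \sum_l `|(k l)%:~R|.

Lemma nrm1_ge0 k : 0 <= nrm1 k.
Proof. by apply: sumr_ge0. Qed.

Lemma sin_natmul_le (x : R) (n : nat) : `|sin (x * n%:R)| <= n%:R * `|sin x|.
Proof.
elim: n => [|n IH]; first by rewrite mulr0 sin0 normr0 mul0r.
rewrite -natr1 mulrDr mulr1 sinD (le_trans (ler_normD _ _))// mulrDl mul1r lerD//.
  by rewrite normrM (le_trans _ IH)// ler_piMr// cos_max.
by rewrite normrM ler_piMl// cos_max.
Qed.

Lemma sin_intmul_le (x : R) (n : int) : `|sin (x * n%:~R)| <= `|n%:~R| * `|sin x|.
Proof.
case: n => n; first by rewrite (le_trans (sin_natmul_le _ _))// normr_nat.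
rewrite NegzE mulrNz mulrN sinN !normrN.
by rewrite (le_trans (sin_natmul_le _ _))// normr_nat.
Qed.

Lemma sin_sum_le (s : seq 'I_8) (x : 'I_8 -> R) :
  `|sin (\sum_(l <- s) x l)| <= \sum_(l <- s) `|sin (x l)|.
Proof.
elim: s => [|l s IH]; first by rewrite !big_nil sin0 normr0.
rewrite !big_cons sinD (le_trans (ler_normD _ _))// lerD//.
  by rewrite normrM ler_piMr// cos_max.
by rewrite normrM (le_trans _ IH)// ler_piMl// cos_max.
Qed.

(* Near each zero of [S2] the oscillating factor vanishes as well: the
   integrand of the fundamental solution is bounded. *)
Lemma sin_sin_ip_le m k c : `|sin (c m)| * `|sin (ip k c)| <= S2 c * nrm1 k.
Proof.
apply: (@le_trans _ _ (`|sin (c m)| * \sum_l (`|(k l)%:~R| * `|sin (c l)|))).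
  rewrite ler_wpM2l// (le_trans (sin_sum_le _ _))// ler_sum// => l _.
  exact: sin_intmul_le.
rewrite /nrm1 !mulr_sumr ler_sum// => l _.
rewrite mulrCA mulrC ler_wpM2r//.
have : `|sin (c m)| ^+ 2 <= S2 c by rewrite real_normK ?num_real// sin2_le_S2.
have : `|sin (c l)| ^+ 2 <= S2 c by rewrite real_normK ?num_real// sin2_le_S2.
by have := sqr_ge0 (`|sin (c m)| - `|sin (c l)|); nra.
Qed.

Lemma S2_eq0 m c : S2 c = 0 -> sin (c m) = 0.
Proof.
move=> S0; apply/eqP; rewrite -sqrf_eq0 eq_le sqr_ge0 andbT.
by rewrite -[leRHS]S0 sin2_le_S2.
Qed.

Lemma bmeas_eint m k : bmeas (eint m k).
Proof.
split.
  apply: mmeasM; last by have [] := bmeas_sin_ip R k.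
  by apply: mmeasM; [exact: mmeas_sin|apply: mmeasV; [exact: mmeas_S2|exact: S2_ge0]].
exists (nrm1 k) => c; rewrite /eint !normrM mulrAC.
have [S0|S0] := eqVneq (S2 c) 0; first by rewrite (S2_eq0 m S0) normr0 !mul0r nrm1_ge0.
have Sp : 0 < S2 c by rewrite lt_def S0 S2_ge0.
by rewrite normfV (gtr0_norm Sp) ler_pdivrMr// [leRHS]mulrC sin_sin_ip_le.
Qed.

(** Component [m] of E^1 without the factor (2 pi)^-8 and the conjugation sign. *)
Definition Ecomp m k : R := I8 (eint m k).

(** The regularised symbol: its square is at most 1 / (S2 + e), so its L2 norm is bounded uniformly
    in [e]. *)
Definition wreg e m c : R := sin (c m) / (S2 c + e).

Lemma bmeas_wreg e m : 0 < e -> bmeas (wreg e m).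
Proof. by move=> e0; apply: bmeasM; [exact: bmeas_sin|exact: bmeas_S2V]. Qed.

(** Off the zeros of [S2] the error is e |sin u_m sin(u.k)| / (S2 (S2 + e)). The numerator is
    controlled by [S2], which leaves [nrm1 k] times e / (S2 + e), of integral at most e [Cgreen]. *)
Lemma wreg_approx e m k : 0 < e ->
  `|I8 (fun c => wreg e m c * sin (ip k c)) - Ecomp m k| <= nrm1 k * e * Cgreen R.
Proof.
move=> e0.
have b1 : bmeas (fun c => wreg e m c * sin (ip k c)).
  by apply: bmeasM; [exact: bmeas_wreg|exact: bmeas_sin_ip].
have b2 : bmeas (fun c => nrm1 k * e * (S2 c + e)^-1).
  exact/bmeasZ/bmeas_S2V.
have b3 := bmeas_eint m k.
have -> : I8 (fun c => wreg e m c * sin (ip k c)) - Ecomp m k =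
   I8 (fun c => wreg e m c * sin (ip k c) - eint m k c) by rewrite IintB.
apply: (@le_trans _ _ (I8 (fun c => nrm1 k * e * (S2 c + e)^-1))); last first.
  rewrite IintZ; last exact: bmeas_S2V.
  by rewrite ler_wpM2l ?Iint_S2V// mulr_ge0 ?nrm1_ge0// ltW.
apply: Iint_norm => //; first exact: bmeasB.
move=> c; rewrite /wreg /eint -mulrBl.
have [S0|S0] := eqVneq (S2 c) 0.
  rewrite (S2_eq0 m S0) !mul0r subr0 mul0r normr0 S0 add0r.
  by rewrite !mulr_ge0 ?nrm1_ge0 ?invr_ge0// ltW.
have Sp : 0 < S2 c by rewrite lt_def S0 S2_ge0.
have Se : 0 < S2 c + e by rewrite addr_gt0.
have -> : (sin (c m) / (S2 c + e) - sin (c m) / S2 c) * sin (ip k c) =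
  - (sin (c m) * sin (ip k c) * (e / (S2 c * (S2 c + e)))).
  by field; rewrite !gt_eqF.
rewrite normrN normrM (@ger0_norm _ (e / _)); last first.
  by rewrite divr_ge0 ?ltW// mulr_gt0.
have -> : nrm1 k * e / (S2 c + e) = S2 c * nrm1 k * (e / (S2 c * (S2 c + e))).
  by field; rewrite !gt_eqF.
rewrite ler_wpM2r ?normrM ?sin_sin_ip_le//.
by rewrite divr_ge0 ?ltW// mulr_gt0.
Qed.

(** The sines for [k] and - [k] are opposite, whence the second delta; for k = k' = 0 the two deltas
    cancel. *)
Lemma I8_sin_sin k k' : I8 (fun c => sin (ip k c) * sin (ip k' c)) =
  V / 2 * ((k == k')%:R - (k == - k')%:R).
Proof.
have -> : (fun c => sin (ip k c) * sin (ip k' c)) =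
  fun c : 'I_8 -> R => 2^-1 * (cos (ip (k - k') c) - cos (ip (k + k') c)).
  by apply/funext => c; rewrite !ipD ipN cosB cosD; field.
have b1 := bmeas_cos_ip R (k - k'); have b2 := bmeas_cos_ip R (k + k').
rewrite IintZ; last exact: bmeasB.
rewrite IintB// !Iint_cos subr_eq0 addr_eq0.
by case: (k == k'); case: (k == - k') => /=; field.
Qed.

(** Expansion of the nonnegative integral of (V w - F)^2, where F is the sine sum with coefficients
    a_k. The constant is V and not V / 2 because [K] may contain both k and -k. *)
Lemma bessel (w : ('I_8 -> R) -> R) (K : seq Z8) : bmeas w -> uniq K ->
  \sum_(k <- K) I8 (fun c => w c * sin (ip k c)) ^+ 2 <= V * I8 (fun c => w c * w c).
Proof.
move=> bw uK.
have V0 : 0 < V by rewrite exprn_gt0// mulr_gt0 ?pi_gt0.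
have [a aE] : exists a : Z8 -> R, forall k, I8 (fun c => w c * sin (ip k c)) = a k by eexists.
under eq_bigr do rewrite aE.
have : forall k k', I8 (fun c => sin (ip k c) * sin (ip k' c)) = V / 2 * ((k == k')%:R - (k == - k')%:R).
  exact: I8_sin_sin.
move: (V) V0 => W8 V0 IS.
pose F c := \sum_(k <- K) a k * sin (ip k c).
have baS k : bmeas (fun c : 'I_8 -> R => a k * sin (ip k c)).
  exact/bmeasZ/bmeas_sin_ip.
have bF : bmeas F by exact: bmeas_sum.
have bwF : bmeas (fun c => w c * F c) by exact: bmeasM.
have bww : bmeas (fun c => w c * w c) by exact: bmeasM.
have bFF : bmeas (fun c => F c * F c) by exact: bmeasM.
have E1 : I8 (fun c => w c * F c) = \sum_(k <- K) a k ^+ 2.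
  have -> : (fun c => w c * F c) = fun c => \sum_(k <- K) a k * (w c * sin (ip k c)).
    by apply/funext => c; rewrite mulr_sumr; apply: eq_bigr => k _; ring.
  have b k : bmeas (fun c => w c * sin (ip k c)).
    by apply: bmeasM => //; exact: bmeas_sin_ip.
  rewrite Iint_sum => [|k]; last exact: bmeasZ.
  by apply: eq_bigr => k _; rewrite IintZ// aE expr2.
have E2 : I8 (fun c => F c * F c) <= W8 * \sum_(k <- K) a k ^+ 2.
  have -> : (fun c => F c * F c) = fun c => \sum_(k <- K) \sum_(k' <- K)
      a k * a k' * (sin (ip k c) * sin (ip k' c)).
    apply/funext => c; rewrite /F big_distrl; apply: eq_bigr => k _ /=.
    by rewrite big_distrr; apply: eq_bigr => k' _ /=; ring.
  have b k k' : bmeas (fun c : 'I_8 -> R => sin (ip k c) * sin (ip k' c)).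
    by apply: bmeasM; exact: bmeas_sin_ip.
  have b' k k' : bmeas (fun c : 'I_8 -> R => a k * a k' * (sin (ip k c) * sin (ip k' c))).
    exact: bmeasZ.
  rewrite Iint_sum => [|k]; last exact: bmeas_sum.
  rewrite mulr_sumr big_seq [leRHS]big_seq; apply: ler_sum => k kK.
  rewrite Iint_sum//.
  have -> : \sum_(k' <- K) I8 (fun c => a k * a k' * (sin (ip k c) * sin (ip k' c))) =
     W8 / 2 * (\sum_(k' <- K) (if k' == k then a k * a k' else 0) -
              \sum_(k' <- K) (if k' == - k then a k * a k' else 0)).
    rewrite -sumrB mulr_sumr; apply: eq_bigr => k' _.
    rewrite IintZ// IS [k == k']eq_sym [k == - k']eq_sym eqr_oppLR.
    by case: (k' == k); case: (k' == - k) => /=; field.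
  rewrite !sum_delta// kK.
  (* If -k lies in [K], its cross term - a_k a_(-k) equals a_k^2 and doubles the diagonal term. *)
  have aN : a (- k) = - a k.
    rewrite -!aE (_ : (fun c => w c * sin (ip (- k) c)) = fun c => -1 * (w c * sin (ip k c))).
      by rewrite IintZ ?mulN1r//; apply: bmeasM => //; exact: bmeas_sin_ip.
    by apply/funext => c; rewrite ipN sinN; ring.
  have a0 : 0 <= a k ^+ 2 by exact: sqr_ge0.
  by case: (_ \in K); rewrite ?aN; nra.
have bVw : bmeas (fun c => W8 * w c - F c) by apply: bmeasB => //; exact: bmeasZ.
have Iww : 0 <= I8 (fun c => (W8 * w c - F c) ^+ 2).
  by apply: Iint_ge0 => [|c]; [exact: bmeasM|exact: sqr_ge0].
have := Iww.
have -> : (fun c => (W8 * w c - F c) ^+ 2) = fun c =>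
  W8 ^+ 2 * (w c * w c) + ((- (2 * W8)) * (w c * F c) + F c * F c).
  by apply/funext => c; ring.
have b1 := bmeasZ (W8 ^+ 2) bww; have b2 := bmeasZ (- (2 * W8)) bwF.
rewrite (IintD _ b1 (bmeasD b2 bFF)) (IintD _ b2 bFF) (IintZ _ _ bww) (IintZ _ _ bwF) E1.
set A := \sum_(k <- K) a k ^+ 2 in E1 E2 *; set W := I8 (fun c => w c * w c).
move=> H; rewrite -subr_ge0.
have : 0 <= W8 * (W8 * W - A).
  have -> : W8 * (W8 * W - A) = W8 ^+ 2 * W + (- (2 * W8) * A + W8 * A) by ring.
  by apply: le_trans H _; rewrite !lerD2l.
by rewrite pmulr_rge0.
Qed.

Lemma half_close (x y e : R) : e <= `|y| -> `|x - y| <= e / 2 -> e ^+ 2 / 4 <= x ^+ 2.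
Proof.
move=> ey xy; have e0 : 0 <= e by have := normr_ge0 (x - y); lra.
have := ler_normB x (x - y); rewrite subKr => yx.
have ex : e / 2 <= `|x| by lra.
rewrite -(real_normK (num_real x)) (_ : e ^+ 2 / 4 = (e / 2) ^+ 2); last by field.
by rewrite lerXn2r ?nnegrE// divr_ge0.
Qed.

(** For a finite [K] a small regularisation keeps all coefficients of modulus at least e / 2, and
    Bessel's inequality then bounds their number independently of the regularisation. *)
Lemma bad_count e m (K : seq Z8) : 0 < e -> uniq K ->
  (forall k, k \in K -> e <= `|Ecomp m k|) ->
  (size K)%:R * e ^+ 2 <= 4 * (V * Cgreen R).
Proof.
move=> e0 uK Ke.
have C0 := Cgreen_ge0 R.
have V0 : 0 < V by rewrite exprn_gt0// mulr_gt0 ?pi_gt0.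
(* [D] dominates [nrm1 k] [Cgreen] for all k in [K] at once, and the summand 1 keeps it positive;
   with d = e / (2 D) every approximation error is at most e / 2. *)
pose D := \sum_(k <- K) nrm1 k * Cgreen R + 1.
have D0 : 0 < D by rewrite ltr_wpDl// sumr_ge0// => k _; rewrite mulr_ge0 ?nrm1_ge0.
pose d := e / (2 * D).
have d0 : 0 < d by rewrite divr_gt0// mulr_gt0.
have big k : k \in K -> e ^+ 2 / 4 <= I8 (fun c => wreg d m c * sin (ip k c)) ^+ 2.
  move=> kK; have := wreg_approx m k d0; have := Ke _ kK.
  set x := I8 _; set y := Ecomp m k => ey xy.
  apply: (half_close (Ke _ kK)); apply: le_trans (wreg_approx m k d0) _.
  have kD : nrm1 k * Cgreen R <= D.
    rewrite /D (bigD1_seq k)//= -addrA lerDl addr_ge0// sumr_ge0// => j _.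
    by rewrite mulr_ge0 ?nrm1_ge0.
  have -> : nrm1 k * d * Cgreen R = nrm1 k * Cgreen R / D * (e / 2).
    by rewrite /d; field; rewrite gt_eqF.
  apply: ler_piMl; last by rewrite ler_pdivrMr// mul1r.
  by apply: divr_ge0 => //; exact: ltW.
have := bessel (bmeas_wreg m d0) uK.
have : (size K)%:R * (e ^+ 2 / 4) <= \sum_(k <- K) I8 (fun c => wreg d m c * sin (ip k c)) ^+ 2.
  have -> : (size K)%:R * (e ^+ 2 / 4) = \sum_(k <- K) e ^+ 2 / 4.
    by rewrite big_const_seq count_predT iter_addr_0 mulr_natl.
  by rewrite big_seq [leRHS]big_seq; apply: ler_sum.
have H2 : V * I8 (fun c => wreg d m c * wreg d m c) <= V * Cgreen R.
  rewrite ler_pM2l//; apply: le_trans (Iint_S2V d0).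
  apply: le_Iint; [apply: bmeasM; exact: bmeas_wreg|exact: bmeas_S2V|].
  move=> c; rewrite /wreg.
  have p0 : 0 < S2 c + d by rewrite ltr_wpDl ?S2_ge0.
  rewrite mulf_div -expr2 ler_pdivrMr ?mulr_gt0// mulKf ?gt_eqF//.
  by rewrite (le_trans (sin2_le_S2 _ _))// lerDl ltW.
move=> H0 H1; have := le_trans H0 (le_trans H1 H2).
by rewrite mulrA ler_pdivrMr// mulrC [leRHS]mulrC [X in X <= _]mulrC.
Qed.

(** By [bad_count] the sets of points with |Ecomp| >= e have bounded size. One of maximal size
    contains all such points, since any further one could be added. *)
Lemma Ecomp_decay e m : 0 < e -> exists s : seq Z8,
  forall k, k \notin s -> `|Ecomp m k| < e.
Proof.
move=> e0.
pose P n := `[< exists K : seq Z8, [/\ uniq K, size K = n &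
  forall k, k \in K -> e <= `|Ecomp m k|] >].
have [N NP] : exists N, forall n, P n -> (n <= N)%N.
  exists (Num.truncn (4 * (V * Cgreen R) / e ^+ 2)) => n /asboolP[K [uK <- Ke]].
  have := bad_count e0 uK Ke; rewrite -ler_pdivlMr ?exprn_gt0// => H.
  by rewrite truncn_ge_nat// (le_trans _ H).
have P0 : exists n, P n by exists 0%N; apply/asboolP; exists [::].
case: (ex_maxnP P0 NP) => n /asboolP[K [uK sK Ke]] nmax.
exists K => k kK; rewrite ltNge; apply/negP => ek.
have /nmax : P n.+1; last by rewrite ltnn.
apply/asboolP; exists (k :: K); split; [by rewrite /= kK|by rewrite /= sK|move=> j].
by rewrite inE => /orP[/eqP ->|jK]; [exact: ek|exact: Ke].
Qed.

(** sin(a + b) - sin(a - b) = 2 sin b cos a makes the integrand symmetric in [l] and [m]. *)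
Lemma Ecomp_diff m l k : Ecomp m (k + basisZ8 l) - Ecomp m (k - basisZ8 l) =
  I8 (fun c => 2 * (sin (c m) * sin (c l) / S2 c * cos (ip k c))).
Proof.
rewrite /Ecomp; have b1 := bmeas_eint m (k + basisZ8 l); have b2 := bmeas_eint m (k - basisZ8 l).
have -> : (fun c => 2 * (sin (c m) * sin (c l) / S2 c * cos (ip k c))) =
  fun c => eint m (k + basisZ8 l) c - eint m (k - basisZ8 l) c.
  apply/funext => c; rewrite /eint !ipD ipN ip_basisZ8 sinD sinB; ring.
by rewrite IintB.
Qed.

End fundamental_solution.

Local Opaque Ecomp.

(** * Symmetry of the differences and discrete divergence of the fundamental solution *)

Section fundamental_solution_identities.
Variable R : realType.
Implicit Types (c : 'I_8 -> R) (k : Z8) (m l : 'I_8).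
Notation I8 F := (Iint ords8 F (fun=> (0 : R))).
Notation V := ((2 * pi : R) ^+ 8).

Lemma Ecomp_diffC m l k : Ecomp R m (k + basisZ8 l) - Ecomp R m (k - basisZ8 l) =
  Ecomp R l (k + basisZ8 m) - Ecomp R l (k - basisZ8 m).
Proof.
apply: (etrans (Ecomp_diff R m l k)); apply: (etrans _ (esym (Ecomp_diff R l m k))).
apply: (congr1 (fun F => Iint ords8 F (fun=> 0))); apply/funext => c.
by rewrite (mulrC (sin (c m))).
Qed.

Lemma small_eq0 (x C : R) : (forall e, 0 < e -> `|x| <= e * C) -> x = 0.
Proof.
move=> H; apply/eqP; rewrite -normr_eq0 eq_le normr_ge0 andbT.
apply/ler_addgt0Pl => e e0; rewrite addr0.
have C1 : 0 < `|C| + 1 by rewrite ltr_wpDl.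
have d0 : 0 < e / (`|C| + 1) by exact: divr_gt0.
rewrite (le_trans (H _ d0))// mulrAC ler_pdivrMr// ler_pM2l//.
by rewrite (le_trans (ler_norm C))// lerDl.
Qed.

(** The summed integrand is 2 (S2 / S2) cos(u.k), which differs from 2 cos(u.k) only where S2 = 0.
    The difference is dominated by 2 e / (S2 + e) for every positive e, so its integral is at most 2
    e [Cgreen] and must vanish. *)
Lemma Ecomp_div k : \sum_l (Ecomp R l (k + basisZ8 l) - Ecomp R l (k - basisZ8 l)) =
  if k == 0 then 2 * V else 0.
Proof.
have bE l : bmeas (fun c => 2 * (sin (c l) * sin (c l) / S2 c * cos (ip k c))).
  have := bmeasB (bmeas_eint R l (k + basisZ8 l)) (bmeas_eint R l (k - basisZ8 l)).
  congr bmeas; apply/funext => c; rewrite /eint !ipD ipN ip_basisZ8 sinD sinB; ring.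
rewrite (eq_bigr _ (fun l _ => Ecomp_diff R l l k)).
have bS := bmeas_sum ords8 bE.
have bc := bmeasZ 2 (bmeas_cos_ip R k).
have -> : (if k == 0 then 2 * V else 0) = I8 (fun c => 2 * cos (ip k c)).
  rewrite IintZ ?Iint_cos; last exact: bmeas_cos_ip.
  by case: ifP => _; rewrite ?mulr0.
rewrite -sum_ords8.
have <- : I8 (fun c => \sum_(l <- ords8) 2 * (sin (c l) * sin (c l) / S2 c * cos (ip k c))) =
    \sum_(l <- ords8) I8 (fun c => 2 * (sin (c l) * sin (c l) / S2 c * cos (ip k c))).
  by rewrite (Iint_sum ords8 ords8 bE).
apply/eqP; rewrite -subr_eq0; apply/eqP.
have <- : I8 (fun c => \sum_(l <- ords8) 2 * (sin (c l) * sin (c l) / S2 c * cos (ip k c)) -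
      2 * cos (ip k c)) =
    I8 (fun c => \sum_(l <- ords8) 2 * (sin (c l) * sin (c l) / S2 c * cos (ip k c))) -
    I8 (fun c => 2 * cos (ip k c)).
  by rewrite IintB.
apply: (@small_eq0 _ (2 * Cgreen R)) => e e0.
have be := bmeasZ (2 * e) (bmeas_S2V e0).
apply: (@le_trans _ _ (I8 (fun c => 2 * e * (S2 c + e)^-1))); last first.
  rewrite IintZ; last exact: bmeas_S2V.
  by rewrite (mulrC 2) -mulrA ler_pM2l// ler_pM2l// Iint_S2V.
apply: Iint_norm => [||c]; [exact: bmeasB|exact: be|].
have -> : \sum_(l <- ords8) 2 * (sin (c l) * sin (c l) / S2 c * cos (ip k c)) =
    2 * (S2 c / S2 c * cos (ip k c)).
  rewrite -mulr_sumr; congr (_ * _); rewrite -!mulr_suml; congr (_ / _ * _).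
  by rewrite sum_ords8.
have [S0|S0] := eqVneq (S2 c) 0; last first.
  rewrite divff// mul1r subrr normr0 !mulr_ge0 ?invr_ge0 ?ltW//.
  by rewrite ltr_wpDl ?S2_ge0.
(* On the zero set S2 / S2 is 0 by convention, and the majorant equals 2, which bounds 2 |cos|. *)
rewrite S0 !mul0r mulr0 !add0r normrN normrM ger0_norm//.
by rewrite mulfK ?gt_eqF// -[leRHS]mulr1 ler_pM2l// cos_max.
Qed.

End fundamental_solution_identities.

(** * Integer structure constants of the octonions *)

Definition sconst (i j m : nat) : int :=
  if i == 0%N then (m == j)%:R else if j == 0%N then (m == i)%:R
  else if m == 0%N then - (i == j)%:R else eps i j m.

Definition osign (m : nat) : int := if m == 0%N then 1 else -1.

(** The constants are integers and tabulated once, so that an exhaustive check over five indices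
    reduces to table lookups. *)
Definition sconst_table : seq (seq (seq int)) := Eval vm_compute in
  [seq [seq [seq sconst i j m | m <- iota 0 8] | j <- iota 0 8] | i <- iota 0 8].

Definition tconst (i j m : nat) : int :=
  nth 0 (nth [::] (nth [::] sconst_table i) j) m.

Lemma tconstE (i j m : 'I_8) : tconst i j m = sconst i j m.
Proof.
have H (k : 'I_8) : (k : nat) \in iota 0 8 by rewrite mem_iota ltn_ord.
have : all (fun i => all (fun j => all (fun m => tconst i j m == sconst i j m)
  (iota 0 8)) (iota 0 8)) (iota 0 8) by vm_compute.
by move=> /allP/(_ _ (H i))/allP/(_ _ (H j))/allP/(_ _ (H m))/eqP.
Qed.

(** Coordinate p of the two relations conj(e_m) (e_l g) + conj(e_l) (e_m g) = 2 delta_lm g and e_l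
    (conj(e_m) g) + e_m (conj(e_l) g) = 2 delta_lm g, for g = e_j. *)
Definition clifford_check : bool :=
  let r := iota 0 8 in
  all (fun l => all (fun m => all (fun j => all (fun p =>
    let d := if (l == m) && (p == j) then 2%Z else 0%Z in
    (foldr (fun n a => osign m * tconst m n p * tconst l j n +
                       osign l * tconst l n p * tconst m j n + a) 0 r == d) &&
    (foldr (fun n a => osign m * tconst l n p * tconst m j n +
                       osign l * tconst m n p * tconst l j n + a) 0 r == d))
   r) r) r) r.

Lemma clifford_check_true : clifford_check.
Proof. by vm_compute. Qed.

Lemma clifford_sconst (l m j p : 'I_8) :
  \sum_(n < 8) (osign m * sconst m n p * sconst l j n +
                osign l * sconst l n p * sconst m j n) = ((l == m) && (p == j))%:R *+ 2 /\
  \sum_(n < 8) (osign m * sconst l n p * sconst m j n +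
                osign l * sconst m n p * sconst l j n) = ((l == m) && (p == j))%:R *+ 2.
Proof.
have H (i : 'I_8) : (i : nat) \in iota 0 8 by rewrite mem_iota ltn_ord.
have := clifford_check_true.
move=> /allP/(_ _ (H l))/allP/(_ _ (H m))/allP/(_ _ (H j))/allP/(_ _ (H p)).
have fE (F : nat -> int) : foldr (fun n a => F n + a) 0 (iota 0 8) = \sum_(n < 8) F n.
  rewrite -(big_mkord xpredT F) unlock /index_iota subn0.
  by elim: (iota 0 8) => //= n s ->.
have dE : (if ((l : nat) == m) && ((p : nat) == j) then 2%Z else 0%Z) =
    ((l == m) && (p == j))%:R *+ 2 by rewrite -!val_eqE; case: ifP.
rewrite !(fE (fun n => _ + _)) dE => /andP[/eqP H1 /eqP H2].
by split; [rewrite -H1|rewrite -H2]; apply: eq_bigr => n _; rewrite !tconstE.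
Qed.

(** * Bilinearity of the octonion product and its Clifford relations *)

Section octonions.
Variable R : realType.
Implicit Types (a b g : oct R).

Lemma emulE i j : emul R i j = \row_m (sconst i j m)%:~R.
Proof.
apply/rowP => m; rewrite /emul /sconst /ebasis.
case: ifP => _; first by rewrite !mxE -val_eqE; case: (_ == _).
case: ifP => _; first by rewrite !mxE -val_eqE; case: (_ == _).
rewrite !mxE; case: ifP => _ //.
by rewrite intrN -val_eqE; case: (_ == _).
Qed.

Lemma omulE a b p : (omul a b) 0 p =
  \sum_(i < 8) \sum_(j < 8) a 0 i * b 0 j * (sconst i j p)%:~R.
Proof.
rewrite /omul summxE; apply: eq_bigr => i _; rewrite summxE.
by apply: eq_bigr => j _; rewrite emulE !mxE.
Qed.

Lemma omulDl a a' b : omul (a + a') b = omul a b + omul a' b.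
Proof.
apply/rowP => p; rewrite mxE !omulE -big_split; apply: eq_bigr => i _ /=.
by rewrite -big_split; apply: eq_bigr => j _ /=; rewrite mxE; ring.
Qed.

Lemma omulDr a b b' : omul a (b + b') = omul a b + omul a b'.
Proof.
apply/rowP => p; rewrite mxE !omulE -big_split; apply: eq_bigr => i _ /=.
by rewrite -big_split; apply: eq_bigr => j _ /=; rewrite mxE; ring.
Qed.

Lemma omulZl t a b : omul (t *: a) b = t *: omul a b.
Proof.
apply/rowP => p; rewrite mxE !omulE mulr_sumr; apply: eq_bigr => i _ /=.
by rewrite mulr_sumr; apply: eq_bigr => j _ /=; rewrite mxE; ring.
Qed.

Lemma omulZr t a b : omul a (t *: b) = t *: omul a b.
Proof.
apply/rowP => p; rewrite mxE !omulE mulr_sumr; apply: eq_bigr => i _ /=.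
by rewrite mulr_sumr; apply: eq_bigr => j _ /=; rewrite mxE; ring.
Qed.

Lemma omul0l b : omul 0 b = 0.
Proof. by rewrite -[0](scale0r (0 : oct R)) omulZl !scale0r. Qed.

Lemma omul0r a : omul a 0 = 0.
Proof. by rewrite -[0](scale0r (0 : oct R)) omulZr !scale0r. Qed.

Lemma omulBl a a' b : omul (a - a') b = omul a b - omul a' b.
Proof. by rewrite omulDl -scaleN1r omulZl scaleN1r. Qed.

Lemma omulBr a b b' : omul a (b - b') = omul a b - omul a b'.
Proof. by rewrite omulDr -scaleN1r omulZr scaleN1r. Qed.

Lemma omul_suml (J : Type) (s : seq J) (F : J -> oct R) b :
  omul (\sum_(j <- s) F j) b = \sum_(j <- s) omul (F j) b.
Proof. by apply: (big_morph (fun a => omul a b)) => [a a'|]; rewrite ?omulDl ?omul0l. Qed.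

Lemma omul_sumr (J : Type) (s : seq J) (F : J -> oct R) a :
  omul a (\sum_(j <- s) F j) = \sum_(j <- s) omul a (F j).
Proof. by apply: (big_morph (omul a)) => [b b'|]; rewrite ?omulDr ?omul0r. Qed.

Definition ebar (m : 'I_8) : oct R := (osign m)%:~R *: ebasis R m.

Lemma omul_ebasisE (l : 'I_8) g p :
  (omul (ebasis R l) g) 0 p = \sum_(j < 8) g 0 j * (sconst l j p)%:~R.
Proof.
rewrite omulE (bigD1 l)//= [X in _ + X]big1 ?addr0 => [|i /negPf il].
  by apply: eq_bigr => j _; rewrite mxE eqxx mul1r.
by rewrite big1// => j _; rewrite mxE il !mul0r.
Qed.

Lemma omul_ebasis2E (l m : 'I_8) g p :
  (omul (ebasis R l) (omul (ebasis R m) g)) 0 p =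
  \sum_(j < 8) g 0 j * (\sum_(n < 8) sconst l n p * sconst m j n)%:~R.
Proof.
rewrite omul_ebasisE; under eq_bigr do rewrite omul_ebasisE mulr_suml.
rewrite exchange_big; apply: eq_bigr => j _ /=.
rewrite rmorph_sum mulr_sumr; apply: eq_bigr => n _ /=.
by rewrite intrM; ring.
Qed.

(** The polarised form of conj(a) (a g) = |a|^2 g, which takes the place of associativity. *)
Lemma omul_ebar_ebasis (l m : 'I_8) g :
  omul (ebar m) (omul (ebasis R l) g) + omul (ebar l) (omul (ebasis R m) g) =
  ((l == m)%:R *+ 2) *: g.
Proof.
apply/rowP => p; rewrite /ebar !omulZl !mxE !omul_ebasis2E !mulr_sumr -big_split /=.
transitivity (\sum_j g 0 j * (((l == m) && (p == j))%:R *+ 2)); last first.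
  rewrite (bigD1 p)//= eqxx andbT big1 ?addr0 => [|j jp]; first by rewrite mulrC.
  by rewrite [p == j]eq_sym (negPf jp) andbF mul0rn mulr0.
apply: eq_bigr => j _.
have -> : ((l == m) && (p == j))%:R *+ 2 = (((l == m) && (p == j))%:R *+ 2 : int)%:~R :> R.
  by rewrite rmorphMn /= rmorph_nat.
rewrite -(clifford_sconst l m j p).1 big_split /= rmorphD /= !rmorph_sum /= mulrDr !mulr_sumr; congr (_ + _); apply: eq_bigr => n _.
  by rewrite !intrM; ring.
by rewrite !intrM; ring.
Qed.

Lemma omul_ebasis_ebar (l m : 'I_8) g :
  omul (ebasis R l) (omul (ebar m) g) + omul (ebasis R m) (omul (ebar l) g) =
  ((l == m)%:R *+ 2) *: g.
Proof.
apply/rowP => p; rewrite /ebar !omulZl !omulZr !mxE !omul_ebasis2E !mulr_sumr -big_split /=.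
transitivity (\sum_j g 0 j * (((l == m) && (p == j))%:R *+ 2)); last first.
  rewrite (bigD1 p)//= eqxx andbT big1 ?addr0 => [|j jp]; first by rewrite mulrC.
  by rewrite [p == j]eq_sym (negPf jp) andbF mul0rn mulr0.
apply: eq_bigr => j _.
have -> : ((l == m) && (p == j))%:R *+ 2 = (((l == m) && (p == j))%:R *+ 2 : int)%:~R :> R.
  by rewrite rmorphMn /= rmorph_nat.
rewrite -(clifford_sconst l m j p).2 big_split /= rmorphD /= !rmorph_sum /= mulrDr !mulr_sumr; congr (_ + _); apply: eq_bigr => n _.
  by rewrite !intrM; ring.
by rewrite !intrM; ring.
Qed.

(* A symmetric array only sees the anticommutators: this is what makes the
   associators of the octonions disappear. *)
Lemma sum_sym_anticomm (T : 'I_8 -> 'I_8 -> R) (X : 'I_8 -> 'I_8 -> oct R) g :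
  (forall l m, T l m = T m l) ->
  (forall l m, X l m + X m l = ((l == m)%:R *+ 2) *: g) ->
  \sum_l \sum_m T l m *: X l m = (\sum_l T l l) *: g.
Proof.
move=> Tsym XX; set Y := LHS.
have YE : Y = \sum_l \sum_m T l m *: X m l.
  rewrite /Y exchange_big; apply: eq_bigr => l _; apply: eq_bigr => m _.
  by rewrite Tsym.
have : Y + Y = 2 *: ((\sum_l T l l) *: g).
  rewrite {1}/Y {1}YE -big_split /= scaler_suml scaler_sumr; apply: eq_bigr => l _.
  rewrite -big_split /= (bigD1 l)//= big1 ?addr0 => [|m ml].
    by rewrite -scalerDr XX eqxx !scalerA mulrC.
  by rewrite -scalerDr XX eq_sym (negPf ml) mul0rn scale0r scaler0.
rewrite -mulr2n -scaler_nat => /(congr1 (fun v => 2^-1 *: v)).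
by rewrite !(scalerA 2^-1) mulVf ?pnatr_eq0// !scale1r.
Qed.

(** In the application T l m is, up to a scalar, the difference in direction [l] of component [m] of
    the fundamental solution, and the trace is its discrete divergence. *)
Lemma sum_omul_ebar_ebasis (T : 'I_8 -> 'I_8 -> R) g : (forall l m, T l m = T m l) ->
  \sum_l omul (\sum_m T l m *: ebar m) (omul (ebasis R l) g) = (\sum_l T l l) *: g.
Proof.
move=> Tsym; rewrite -(@sum_sym_anticomm T (fun l m => omul (ebar m) (omul (ebasis R l) g)))//.
  by apply: eq_bigr => l _; rewrite omul_suml; apply: eq_bigr => m _; rewrite omulZl.
by move=> l m; exact: omul_ebar_ebasis.
Qed.

Lemma sum_omul_ebasis_ebar (T : 'I_8 -> 'I_8 -> R) g : (forall l m, T l m = T m l) ->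
  \sum_l omul (ebasis R l) (omul (\sum_m T l m *: ebar m) g) = (\sum_l T l l) *: g.
Proof.
move=> Tsym; rewrite -(@sum_sym_anticomm T (fun l m => omul (ebasis R l) (omul (ebar m) g)))//.
  apply: eq_bigr => l _; rewrite omul_suml omul_sumr; apply: eq_bigr => m _.
  by rewrite omulZl omulZr.
by move=> l m; exact: omul_ebasis_ebar.
Qed.

End octonions.

(** * Summation by parts and the potential of an abstract Cauchy kernel *)

Lemma big_supp (A : zmodType) (J : eqType) (s1 s2 : seq J) (F : J -> A) :
  uniq s1 -> uniq s2 -> (forall j, F j != 0 -> (j \in s1) && (j \in s2)) ->
  \sum_(j <- s1) F j = \sum_(j <- s2) F j.
Proof.
move=> u1 u2 H.
have E (s : seq J) : \sum_(j <- s) F j = \sum_(j <- [seq j <- s | F j != 0]) F j.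
  rewrite big_filter [RHS]big_mkcond; apply: eq_bigr => j _.
  by case: eqP => //= ->.
rewrite (E s1) (E s2); apply: perm_big; apply: uniq_perm; rewrite ?filter_uniq//.
move=> j; rewrite !mem_filter; case: eqVneq => //= Fj.
by have /andP[-> ->] := H _ Fj.
Qed.

Lemma big_shift (A Z : zmodType) (s : seq Z) (F : Z -> A) (a : Z) : uniq s ->
  (forall x, F x != 0 -> (x \in s) && (x - a \in s)) ->
  \sum_(x <- s) F x = \sum_(x <- s) F (x + a).
Proof.
move=> us H; rewrite -(big_map (fun x => x + a) xpredT F).
apply: big_supp => //; first by rewrite map_inj_uniq//; exact: addIr.
move=> x /H /andP[-> xa] /=; apply/mapP; exists (x - a) => //.
by rewrite subrK.
Qed.

Section potential.
Variables (R : realType) (Z : zmodType) (e : 'I_8 -> Z) (E : Z -> oct R) (k0 : R).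
Hypothesis cauchy_left : forall k a,
  \sum_l omul (E (k + e l) - E (k - e l)) (omul (ebasis R l) a) =
  (if k == 0 then k0 else 0) *: a.
Hypothesis cauchy_right : forall k a,
  \sum_l omul (ebasis R l) (omul (E (k + e l) - E (k - e l)) a) =
  (if k == 0 then k0 else 0) *: a.
Variables (c : Z -> R) (s : seq Z).
Hypotheses (us : uniq s) (cs : forall x, c x != 0 -> x \in s)
  (csD : forall x l, c x != 0 -> x + e l \in s)
  (csB : forall x l, c x != 0 -> x - e l \in s).
Implicit Types (g : Z -> oct R) (x y : Z).

(** This is 2 h D^h, free of the mesh size. *)
Definition dirac_sum g x : oct R :=
  \sum_l omul (ebasis R l) (g (x + e l) - g (x - e l)).

Definition potential g y : oct R :=
  \sum_(x <- s) c x *: omul (E (y - x)) (dirac_sum g x).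

(** For [c] the indicator of B this is, up to the factor h^7 / 2, the boundary integrand s(x) K^h(x,
    y) * g(x): the differences of [c] are the unnormalised normals. It vanishes off the boundary,
    which lets the sum run over all of [s]. *)
Definition flux g y x : oct R := \sum_l
  (omul ((c x - c (x - e l)) *: E (y - x + e l)) (omul (ebasis R l) (g x)) +
   omul ((c (x + e l) - c x) *: E (y - x - e l)) (omul (ebasis R l) (g x))).

Lemma sum_at (F : Z -> oct R) y :
  \sum_(x <- s) c x *: ((if y - x == 0 then k0 else 0) *: F x) = (k0 * c y) *: F y.
Proof.
transitivity (\sum_(x <- s) if x == y then (k0 * c x) *: F x else 0).
  apply: eq_bigr => x _; rewrite subr_eq0 [y == x]eq_sym.
  by case: eqP => _; rewrite ?scale0r ?scaler0// scalerA mulrC.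
rewrite sum_delta//; case: ifPn => // ys.
have [->|c0] := eqVneq (c y) 0; first by rewrite mulr0 scale0r.
by move: ys; rewrite cs.
Qed.

(* Discrete Borel-Pompeiu formula: summation by parts moves the difference
   quotients from [c] onto [E] and [g]. *)
Lemma sum_flux g y : \sum_(x <- s) flux g y x = (k0 * c y) *: g y - potential g y.
Proof.
pose A l x := omul (E (y - x + e l)) (omul (ebasis R l) (g x)).
pose C l x := omul (E (y - x - e l)) (omul (ebasis R l) (g x)).
have shiftA l : \sum_(x <- s) c (x - e l) *: A l x =
    \sum_(x <- s) c x *: omul (E (y - x)) (omul (ebasis R l) (g (x + e l))).
  rewrite (@big_shift _ _ s _ (e l)) // => [|x]; last first.
    rewrite scaler_eq0 negb_or => /andP[c0 _]; rewrite (cs c0) andbT.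
    by rewrite -[x](subrK (e l)) csD.
  apply: eq_bigr => x _; rewrite addrK /A; congr (_ *: omul (E _) _).
  by rewrite opprD addrA subrK.
have shiftC l : \sum_(x <- s) c (x + e l) *: C l x =
    \sum_(x <- s) c x *: omul (E (y - x)) (omul (ebasis R l) (g (x - e l))).
  rewrite (@big_shift _ _ s _ (- e l)) // => [|x]; last first.
    rewrite opprK scaler_eq0 negb_or => /andP[c0 _]; rewrite (cs c0) andbT.
    by rewrite -[x](addrK (e l)) csB.
  apply: eq_bigr => x _; rewrite subrK /C; congr (_ *: omul (E _) _).
  by rewrite opprD opprK addrA addrK.
rewrite /potential -(sum_at g) -sumrB.
transitivity (\sum_l \sum_(x <- s) c x *:
   (omul (E (y - x + e l) - E (y - x - e l)) (omul (ebasis R l) (g x)) -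
    omul (E (y - x)) (omul (ebasis R l) (g (x + e l) - g (x - e l))))).
  rewrite exchange_big; apply: eq_bigr => l _ /=.
  (* The unshifted terms give [c x] times the difference of [E]; the shifted ones, once reindexed,
     give [c x] times the difference of [g]. *)
  transitivity (\sum_(x <- s) c x *: (A l x - C l x) -
    (\sum_(x <- s) c (x - e l) *: A l x - \sum_(x <- s) c (x + e l) *: C l x)).
    rewrite -!sumrB; apply: eq_bigr => x _.
    rewrite !omulZl -/(A l x) -/(C l x); move: (A l x) (C l x) => a b.
    by apply/rowP => i; rewrite !mxE; ring.
  rewrite shiftA shiftC -!sumrB; apply: eq_bigr => x _.
  by rewrite omulBl !omulBr !scalerBr.
rewrite exchange_big; apply: eq_bigr => x _ /=.
by rewrite -scaler_sumr sumrB cauchy_left -omul_sumr scalerBr.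
Qed.

(** For each x the operator meets [E] times a fixed octonion, with exactly the bracketing of
    [cauchy_right]; the resulting delta selects x = y. *)
Lemma dirac_sum_potential g y :
  dirac_sum (potential g) y = (k0 * c y) *: dirac_sum g y.
Proof.
rewrite -sum_at.
transitivity (\sum_l \sum_(x <- s) c x *: omul (ebasis R l)
    (omul (E (y - x + e l) - E (y - x - e l)) (dirac_sum g x))).
  apply: eq_bigr => l _; rewrite /potential -sumrB omul_sumr; apply: eq_bigr => x _.
  rewrite (addrAC y (e l)) (addrAC y (- e l)).
  rewrite -scalerBr.
  rewrite -omulBl.
  by rewrite omulZr.
rewrite exchange_big; apply: eq_bigr => x _ /=.
by rewrite -scaler_sumr cauchy_right.
Qed.

(** Differences kill constants. Hence the subtraction of g(y) in the definition of S^h does not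
    affect the potential. *)
Lemma potentialB_cst g (a : oct R) y : potential (fun x => g x - a) y = potential g y.
Proof.
apply: eq_bigr => x _; congr (_ *: omul _ _); apply: eq_bigr => l _.
by congr (omul _ _); rewrite opprB addrA subrK.
Qed.

End potential.

(** * Lattice translations and a finite box around a bounded set *)

Lemma shiftE (x : Z8) (l : 'I_8) :
  prod (Defs.shift x l 1 = x + basisZ8 l) (Defs.shift x l (-1) = x - basisZ8 l).
Proof.
by split; apply/ffunP => i; rewrite !ffunE //; case: eqP; rewrite ?oppr0.
Qed.

Lemma kidxE (l : 'I_8) (x y : Z8) :
  prod (kidx l 1 x y = y - x + basisZ8 l) (kidx l (-1) x y = y - x - basisZ8 l).
Proof.
by split; apply/ffunP => i; rewrite !ffunE; case: eqP => _; rewrite ?oppr0; ring.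
Qed.

Lemma nbhd_cover (B : set Z8) : lat_bounded B -> exists s : seq Z8,
  [/\ uniq s, forall x, B x -> x \in s & forall x z, nbhd x z -> B z -> x \in s].
Proof.
move=> [M BM].
(* The cube of integer points with coordinates between -(M+1) and M+1, hence 2 (M+1) + 1 values
   each; the extra layer accommodates the neighbours of B. *)
pose p (t : {ffun 'I_8 -> 'I_(M.+1.*2.+1)}) : Z8 := [ffun i => (t i)%:Z - M.+1%:Z].
have mem (x : Z8) : (forall i, `|x i| <= M.+1%:Z) -> x \in undup [seq p t | t : {ffun 'I_8 -> 'I_(M.+1.*2.+1)}].
  move=> xM; rewrite mem_undup; apply/fintype.imageP.
  exists [ffun i => inord (absz (x i + M.+1%:Z))] => //.
  apply/ffunP => i; rewrite !ffunE.
  have := xM i; rewrite ler_norml => /andP[h1 h2].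
  have h3 : 0 <= x i + M.+1%:Z by lia.
  have h4 := gez0_abs h3; move: (absz _) h4 => z h4.
  by rewrite inordK; [rewrite h4 addrK|lia].
exists (undup [seq p t | t : {ffun 'I_8 -> 'I_(M.+1.*2.+1)}]).
split; first exact: undup_uniq.
  by move=> x /BM xM; apply: mem => i; have := xM i; lia.
move=> x z xz /BM zM; apply: mem => i; have := zM i.
by case: xz => [->|[l [->|->]]]; rewrite ?ffunE; try case: eqP; lia.
Qed.

(** * Functions vanishing at infinity, the kernel E^h and the boundary of B *)

Section lattice.
Variable R : realType.
Implicit Types (l m i : 'I_8) (k x y : Z8) (F : Z8 -> R) (h : R) (B : set Z8) (f g : Z8 -> oct R).

(** Convergence to 0 along the cofinite filter, which on the lattice is convergence to 0 at
    infinity. *)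
Definition vanishes F := forall e : R, 0 < e -> exists s : seq Z8,
  forall k, k \notin s -> `|F k| < e.

Lemma vanishes0 : vanishes (fun=> 0).
Proof. by move=> e e0; exists [::] => k _; rewrite normr0. Qed.

Lemma vanishesD F G : vanishes F -> vanishes G -> vanishes (fun k => F k + G k).
Proof.
move=> vF vG e e0; have e2 : 0 < e / 2 by rewrite divr_gt0.
have [s Fs] := vF _ e2; have [t Gt] := vG _ e2.
exists (s ++ t) => k; rewrite mem_cat negb_or => /andP[/Fs h1 /Gt h2].
by rewrite (le_lt_trans (ler_normD _ _))//; lra.
Qed.

Lemma vanishesZ F (a : R) : vanishes F -> vanishes (fun k => a * F k).
Proof.
move=> vF e e0; have a1 : 0 < `|a| + 1 by rewrite ltr_wpDl.
have [|s Fs] := vF (e / (`|a| + 1)); first by rewrite divr_gt0.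
exists s => k /Fs; rewrite ltr_pdivlMr// normrM; apply: le_lt_trans.
by rewrite mulrC ler_wpM2l// lerDl.
Qed.

Lemma vanishes_norm F : vanishes F -> vanishes (fun k => `|F k|).
Proof. by move=> vF e /vF[s Fs]; exists s => k /Fs; rewrite normr_id. Qed.

Lemma vanishes_shift F (a : Z8) : vanishes F -> vanishes (fun k => F (k - a)).
Proof.
move=> vF e /vF[s Fs]; exists [seq x + a | x <- s] => k kn; apply: Fs.
apply: contra kn => ks; apply/mapP; exists (k - a) => //.
by rewrite subrK.
Qed.

Lemma vanishes_sum (J : Type) (r : seq J) (F : J -> Z8 -> R) :
  (forall j, vanishes (F j)) -> vanishes (fun k => \sum_(j <- r) F j k).
Proof.
move=> vF; elim: r => [|j r IH].
  rewrite (_ : (fun k => _) = fun=> 0); first exact: vanishes0.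
  by apply/funext => k; rewrite big_nil.
rewrite (_ : (fun k => _) = fun k => F j k + \sum_(j <- r) F j k).
  exact: vanishesD.
by apply/funext => k; rewrite big_cons.
Qed.

Lemma onorm_le (a : oct R) : onorm a <= \sum_i `|a 0 i|.
Proof.
rewrite /onorm; have S0 : 0 <= \sum_i `|a 0 i| by apply: sumr_ge0.
rewrite -(ger0_norm S0) -sqrtr_sqr ler_wsqrtr// expr2 mulr_suml ler_sum// => i _.
rewrite -(real_normK (num_real (a 0 i))) expr2 ler_wpM2l// (bigD1 i)//= lerDl.
by apply: sumr_ge0.
Qed.

Lemma EhE h k : Eh h k = \sum_m (h ^- 7 * (2 * pi) ^- 8 * Ecomp R m k) *: ebar R m.
Proof.
apply/rowP => p; rewrite summxE (bigD1 p)//= big1 ?addr0 => [|m mp]; last first.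
  by rewrite !mxE eq_sym (negPf mp) !mulr0.
rewrite !mxE eqxx mulr1.
have -> : int8 (E1integrand k p) = (osign p)%:~R * Ecomp R p k.
  rewrite int8E (_ : E1integrand k p = fun c => (osign p)%:~R * eint p k c).
    by rewrite IintZ//; exact: bmeas_eint.
  apply/funext => c; rewrite /E1integrand /eint /osign.
  by case: eqP => _; rewrite -!mulrA; congr (_ * _).
ring.
Qed.

Lemma Eh_diff h l k : Eh h (k + basisZ8 l) - Eh h (k - basisZ8 l) =
  \sum_m (h ^- 7 * (2 * pi) ^- 8 * (Ecomp R m (k + basisZ8 l) - Ecomp R m (k - basisZ8 l))) *: ebar R m.
Proof.
by rewrite !EhE -sumrB; apply: eq_bigr => m _; rewrite -scalerBl mulrBr.
Qed.

Lemma Eh_diff_trace h k :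
  \sum_l h ^- 7 * (2 * pi) ^- 8 * (Ecomp R l (k + basisZ8 l) - Ecomp R l (k - basisZ8 l)) =
  if k == 0 then 2 * h ^- 7 else 0.
Proof.
rewrite -mulr_sumr Ecomp_div; case: ifP => _; last by rewrite mulr0.
have p0 : 2 * pi != 0 :> R by rewrite mulf_neq0 ?gt_eqF ?pi_gt0.
by rewrite mulrCA -mulrA mulVf ?mulr1 ?expf_neq0// mulrC.
Qed.

Lemma Eh_diff_sym h k l m :
  h ^- 7 * (2 * pi) ^- 8 * (Ecomp R m (k + basisZ8 l) - Ecomp R m (k - basisZ8 l)) =
  h ^- 7 * (2 * pi) ^- 8 * (Ecomp R l (k + basisZ8 m) - Ecomp R l (k - basisZ8 m)).
Proof. exact: (congr1 (fun z => _ * z) (Ecomp_diffC R m l k)). Qed.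

(** The differences are not divided by 2 h, so 2 h^-7 = 2 h h^-8 expresses that D^h E^h is h^-8
    times the delta function, here with D^h acting from the right and bracketed with [a]. *)
Lemma Eh_cauchy h k (a : oct R) :
  \sum_l omul (Eh h (k + basisZ8 l) - Eh h (k - basisZ8 l)) (omul (ebasis R l) a) =
  (if k == 0 then 2 * h ^- 7 else 0) *: a.
Proof.
rewrite -Eh_diff_trace -(sum_omul_ebar_ebasis _ (Eh_diff_sym h k)).
by apply: eq_bigr => l _; rewrite Eh_diff.
Qed.

Lemma Eh_fundamental h k (a : oct R) :
  \sum_l omul (ebasis R l) (omul (Eh h (k + basisZ8 l) - Eh h (k - basisZ8 l)) a) =
  (if k == 0 then 2 * h ^- 7 else 0) *: a.
Proof.
rewrite -Eh_diff_trace -(sum_omul_ebasis_ebar _ (Eh_diff_sym h k)).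
by apply: eq_bigr => l _; rewrite Eh_diff.
Qed.

Lemma vanishes_Eh h i : vanishes (fun k => (Eh h k) 0 i).
Proof.
rewrite (_ : (fun k => _) = fun k => \sum_m
    ((ebar R m) 0 i * (h ^- 7 * (2 * pi) ^- 8)) * Ecomp R m k).
  apply: vanishes_sum => m; apply: vanishesZ => e e0; exact: Ecomp_decay.
apply/funext => k; rewrite EhE summxE; apply: eq_bigr => m _.
by rewrite mxE mulrC mulrA.
Qed.

Lemma DhE h g x : Dh h g x = (2 * h)^-1 *: dirac_sum basisZ8 g x.
Proof.
rewrite /Dh scaler_sumr; apply: eq_bigr => l _.
rewrite -omulZr /dcentO /dplusO /dminusO !shiftE -scalerDr scalerA -invfM.
by rewrite addrA subrK.
Qed.

Lemma bd_chi B x l : ~ bd B x -> chi R B (x + basisZ8 l) = chi R B x /\ chi R B (x - basisZ8 l) = chi R B x.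
Proof.
move=> nb.
have H z : nbhd x z -> chi R B z = chi R B x.
  move=> xz; rewrite /chi !indicE; congr ((_ : bool)%:R).
  have xx : nbhd x x by left.
  case: (pselect (B x)) (pselect (B z)) => Bx [] Bz.
  - by rewrite !mem_set.
  - by exfalso; apply: nb; split; [exists x|exists z].
  - by exfalso; apply: nb; split; [exists z|exists x].
  - by rewrite !memNset.
by split; apply: H; right; exists l; [left|right]; rewrite shiftE.
Qed.

Lemma bd_Sig_gt0 h B x : h != 0 -> bd B x -> 0 < Sig h B x.
Proof.
move=> h0 [[z [xz Bz]] [w [xw Bw]]].
have S0 : 0 <= Sig h B x by apply: sumr_ge0 => l _; rewrite addr_ge0 ?sqr_ge0.
rewrite lt_def S0 andbT; apply/eqP => SE.
have H l : chi R B (x + basisZ8 l) = chi R B x /\ chi R B (x - basisZ8 l) = chi R B x.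
  have : dplusR h (chi R B) l x ^+ 2 + dminusR h (chi R B) l x ^+ 2 == 0.
    move/eqP: SE; rewrite psumr_eq0 => [/allP/(_ l)|i _]; last by rewrite addr_ge0 ?sqr_ge0.
    by rewrite mem_index_enum => /(_ isT).
  rewrite paddr_eq0 ?sqr_ge0// !sqrf_eq0 /dplusR /dminusR !shiftE !mulf_eq0 invr_eq0 (negPf h0) !orbF.
  by rewrite !subr_eq0 => /andP[/eqP -> /eqP ->].
have N u : nbhd x u -> chi R B u = chi R B x.
  by case=> [->//|[l [->|->]]]; rewrite shiftE; have [] := H l.
have := N _ xz; rewrite -(N _ xw) /chi !indicE mem_set// memNset//.
by move/eqP; rewrite oner_eq0.
Qed.


(** The root of [Sig], nonzero on the boundary, cancels between the area h^8 sqrt(Sig) / 2 and the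
    normals; the 1 / h of the difference quotients leaves h^7 / 2. *)
Lemma Kstar_flux h B x y g : 0 < h -> bd B x ->
  sarea h B x *: Kstar h B x y (g x) =
  (h ^+ 7 / 2) *: flux basisZ8 (Eh h) (chi R B) g y x.
Proof.
move=> h0 bx; have hn0 : h != 0 by rewrite gt_eqF.
have q0 : Num.sqrt (Sig h B x) != 0 by rewrite gt_eqF// sqrtr_gt0 bd_Sig_gt0.
have c1 l : sarea h B x * (- 2^-1 * nminus h B l x) =
    h ^+ 7 / 2 * (chi R B x - chi R B (x - basisZ8 l)).
  rewrite /sarea /nminus /dminusR !shiftE; move: q0; set q := Num.sqrt _ => q0.
  by field; rewrite q0 hn0.
have c2 l : sarea h B x * (- 2^-1 * nplus h B l x) =
    h ^+ 7 / 2 * (chi R B (x + basisZ8 l) - chi R B x).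
  rewrite /sarea /nplus /dplusR !shiftE; move: q0; set q := Num.sqrt _ => q0.
  by field; rewrite q0 hn0.
rewrite /Kstar /flux !scaler_sumr; apply: eq_bigr => l _.
rewrite !kidxE -omulDl -!omulZl; move: (Eh _ _) (Eh _ _) => E1 E2.
rewrite !scalerDr !scalerA -(c1 l) -(c2 l).
move: (sarea _ _ _) (nminus _ _ _ _) (nplus _ _ _ _) => a1 a2 a3.
by rewrite !mulrA.
Qed.

Lemma flux_eq0 (p q r : R) (a a' b : oct R) : p = r -> q = r ->
  omul ((r - q) *: a) b + omul ((p - r) *: a') b = 0.
Proof. by move=> -> ->; rewrite !subrr !scale0r !omul0l addr0. Qed.

Lemma sum_bd_flux h B (s : seq Z8) y g : 0 < h -> uniq s ->
  (forall x z, nbhd x z -> B z -> x \in s) ->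
  \sum_(x \in bd B) sarea h B x *: Kstar h B x y (g x) =
  (h ^+ 7 / 2) *: \sum_(x <- s) flux basisZ8 (Eh h) (chi R B) g y x.
Proof.
move=> h0 us sB.
(* A boundary point has a neighbour in B, hence belongs to [s]; the remaining points of [s] carry no
   flux. *)
have -> : bd B = [set` [seq x <- s | x \in bd B]].
  apply/seteqP; split => x /=; rewrite mem_filter.
    move=> bx; rewrite mem_set//=; case: bx => [[z [xz Bz]] _]; exact: sB xz Bz.
  by move=> /andP[/set_mem].
rewrite -fsbig_seq ?filter_uniq// big_filter big_mkcond scaler_sumr.
apply: eq_bigr => x _; case: ifPn => [/set_mem bx|/negP bx]; first exact: Kstar_flux.
suff -> : flux basisZ8 (Eh h) (chi R B) g y x = 0 by rewrite scaler0.
apply: big1 => l _.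
have [|c1 c2] := @bd_chi B x l; first by move=> bx'; apply: bx; rewrite mem_set.
exact: flux_eq0 c1 c2.
Qed.

Lemma chiE B x : (B x -> chi R B x = 1) /\ (~ B x -> chi R B x = 0).
Proof. by rewrite /chi indicE; split=> Bx; [rewrite mem_set|rewrite memNset]. Qed.

Lemma chi_neq0 B x : chi R B x != 0 -> B x.
Proof.
by move=> c0; apply: contrapT => /((chiE B x).2) c1; rewrite c1 eqxx in c0.
Qed.

(** * The Teodorescu operator of B and the singular operator S^h *)

Section concrete_potential.
Variables (h : R) (B : set Z8) (s : seq Z8).
Hypotheses (h0 : 0 < h) (us : uniq s) (sB : forall x, B x -> x \in s)
  (sN : forall x z, nbhd x z -> B z -> x \in s).

Let chi_s x : chi R B x != 0 -> x \in s.
Proof. by move=> /chi_neq0; exact: sB. Qed.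

Let chi_sD x l : chi R B x != 0 -> x + basisZ8 l \in s.
Proof.
move=> /chi_neq0 Bx; apply: (sN _ Bx); right; exists l; right.
by rewrite shiftE addrK.
Qed.

Let chi_sB x l : chi R B x != 0 -> x - basisZ8 l \in s.
Proof.
move=> /chi_neq0 Bx; apply: (sN _ Bx); right; exists l; left.
by rewrite shiftE subrK.
Qed.

(** The operator T. The weight h^8 combines with the factor 1 / (2 h) missing from [dirac_sum] to
    give h^7 / 2. *)
Definition teodorescu f y : oct R :=
  (h ^+ 7 / 2) *: potential basisZ8 (Eh h) (chi R B) s f y.

(** The discrete Borel-Pompeiu formula with its true constants: h^7 / 2 cancels the 2 h^-7 of the
    Cauchy identity. *)
Lemma sum_bd_Kstar g y :
  \sum_(x \in bd B) sarea h B x *: Kstar h B x y (g x) =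
  chi R B y *: g y - teodorescu g y.
Proof.
have hn0 : h != 0 by rewrite gt_eqF.
rewrite (sum_bd_flux y g h0 us sN).
rewrite (sum_flux (Eh_cauchy h) us chi_s chi_sD chi_sB g y) scalerBr scalerA.
by congr (_ *: _ - _); field.
Qed.

(** The function f - f(y) vanishes at y, which removes the indicator term: the formula is the same
    for boundary points inside and outside B. *)
Lemma ShE f y : Sh h B f y = f y - 2 *: teodorescu f y.
Proof.
rewrite /Sh (sum_bd_Kstar (fun x => f x - f y) y) /teodorescu potentialB_cst.
by rewrite subrr scaler0 sub0r scalerN addrC.
Qed.

Lemma Dh_teodorescu f y : Dh h (teodorescu f) y = chi R B y *: Dh h f y.
Proof.
have hn0 : h != 0 by rewrite gt_eqF.
have := dirac_sum_potential (Eh_fundamental h) us chi_s f y.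
rewrite !DhE /dirac_sum /teodorescu => P.
transitivity ((2 * h)^-1 *: ((h ^+ 7 / 2) *: dirac_sum basisZ8
    (potential basisZ8 (Eh h) (chi R B) s f) y)).
  congr (_ *: _); rewrite /dirac_sum scaler_sumr; apply: eq_bigr => l _.
  by rewrite -scalerBr omulZr.
rewrite /dirac_sum P !scalerA; congr (_ *: _); field.
by rewrite hn0.
Qed.

(** Each component of T f is a finite linear combination of translates of components of E^h, all of
    which vanish at infinity. *)
Lemma vanishes_teodorescu f : vanishes (fun y => \sum_i `|(teodorescu f y) 0 i|).
Proof.
apply: vanishes_sum => i; apply: vanishes_norm.
rewrite (_ : (fun y => _) = fun y => \sum_(x <- s) \sum_(j < 8) \sum_(l < 8)
  (h ^+ 7 / 2 * chi R B x * (dirac_sum basisZ8 f x) 0 l * (sconst j l i)%:~R) *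
  (Eh h (y - x)) 0 j).
  apply: vanishes_sum => x; apply: vanishes_sum => j; apply: vanishes_sum => l.
  apply: vanishesZ; exact: (vanishes_shift x (vanishes_Eh h j)).
apply/funext => y; rewrite /teodorescu /potential mxE summxE mulr_sumr; apply: eq_bigr => x _.
rewrite mxE omulE !mulr_sumr; apply: eq_bigr => j _.
by rewrite !mulr_sumr; apply: eq_bigr => l _; ring.
Qed.

End concrete_potential.

End lattice.

(** * The discrete monogenic extensions of the two Plemelj projections *)

Theorem mainTheorem11 (R : realType) (h : R) (B : set Z8) (f : Z8 -> oct R) :
  0 < h -> lat_bounded B ->
  (exists u : Z8 -> oct R,
      (forall y, B y -> Dh h u y = 0) /\
      (forall y, bd B y -> u y = Ph h B f y)) /\
  (exists v : Z8 -> oct R,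
      (forall y, ~ B y -> Dh h v y = 0) /\
      (forall y, bd B y -> v y = Qh h B f y) /\
      (forall e : R, 0 < e -> exists M : R, forall y,
          clos (~` B) y -> M < latnorm h y -> onorm (v y) < e)).
Proof.
move=> h0 /nbhd_cover[s [us sB sN]].
pose T := teodorescu h B s f.
have DT y : Dh h T y = chi R B y *: Dh h f y by exact: Dh_teodorescu.
have SE y : Sh h B f y = f y - 2 *: T y by exact: ShE.
have half (a : oct R) : 2^-1 *: (2 *: a) = a.
  by rewrite scalerA mulVf ?scale1r ?pnatr_eq0.
have half2 (a : oct R) : a + a = 2 *: a by rewrite -mulr2n -scaler_nat.
split.
  (* Off the boundary [f] serves as an arbitrary extension of the boundary data; at boundary points
     [Ph] and [Qh] only see the boundary values. *)
  exists (fun y => f y - T y); split => y By.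
    transitivity (Dh h f y - Dh h T y).
      rewrite !DhE -scalerBr -sumrB; congr (_ *: _); apply: eq_bigr => l _.
      rewrite -omulBr; congr (omul _ _).
      by move: (f _) (f _) (T _) (T _) => a b a' b'; apply/rowP => i; rewrite !mxE; ring.
    by rewrite DT (chiE R B y).1// scale1r subrr.
  by rewrite /Ph SE addrA half2 -scalerBr half.
exists T; split; [|split].
- by move=> y nBy; rewrite DT (chiE R B y).2// scale0r.
- by move=> y _; rewrite /Qh SE opprB addrC subrK half.
- move=> e e0; have [t Ht] := vanishes_teodorescu h B s f e0.
  (* The sum of the norms of the finitely many exceptional points bounds the norm of each of
     them. *)
  exists (\sum_(k <- t) latnorm h k) => y _ ty.
  apply: le_lt_trans (onorm_le _) _; apply: le_lt_trans (ler_norm _) _; apply: Ht.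
  apply: contraTN ty => yt; rewrite -leNgt (big_rem y)//= lerDl.
  by apply: sumr_ge0 => k _; exact: sqrtr_ge0.
Qed.
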